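(* For any compact set $E \subset \mathbb{R}^2$ and $\varepsilon > 0$, the set $\mathcal{C}(\partial E_\varepsilon)$ of chain singularities is closed and totally disconnected.
   Context: $B_r(x)$ is the open Euclidean ball and $E_\varepsilon := \overline{\bigcup_{p \in E} B_\varepsilon(p)}$. For $x \in \partial E_\varepsilon$ the set of contributors is $\Pi_E(x) = \{y \in \partial E : \|y-x\| = \varepsilon\}$, and $\mathrm{Unp}_\varepsilon(E) := \{x \in \partial E_\varepsilon : \Pi_E(x) \text{ is a singleton}\}$. A point $x \in \partial E_\varepsilon$ is smooth if there is $r>0$ with $\partial E_\varepsilon \cap B_r(x) \subset \mathrm{Unp}_\varepsilon(E)$; otherwise it is a singularity, and $S(E_\varepsilon)$ denotes the set of singularities. A vector $\xi \in S^1$ is an outward direction at $x$ if there is a sequence $(x_n) \subset \mathbb{R}^2 \setminus E_\varepsilon$ with $x_n \to x$ and $(x_n - x)/\|x_n - x\| \to \xi$; the set of these is $\Xi_x(E_\varepsilon)$. If $\xi \in \Xi_x(E_\varepsilon)$ and $y \in \Pi_E(x)$ satisfy $\langle y - x, \xi\rangle = 0$, then $\xi$ is an extremal outward direction and $y$ an extremal contributor at $x$; the sets of these are $\Xi_x^{\mathrm{ext}}(E_\varepsilon)$ and $\Pi_E^{\mathrm{ext}}(x)$. Each has one or two elements; write $\Xi_x^{\mathrm{ext}}(E_\varepsilon) = \{\xi_1,\xi_2\}$, allowing $\xi_1=\xi_2$, and similarly for $\Pi_E^{\mathrm{ext}}$. For $v \in S^1$ let $U_r(x,v) := \{z \in B_r(x)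 : \langle z - x, v\rangle > 0\}$. Say a sequence of singularities $(x_n)$ has asymptotically opposite contributors if $\left\langle \frac{y_n^{(1)}-x_n}{\varepsilon}, \frac{y_n^{(2)}-x_n}{\varepsilon}\right\rangle \to -1$, where $\{y_n^{(1)},y_n^{(2)}\} = \Pi_E^{\mathrm{ext}}(x_n)$ (possibly with equal elements). A singularity $x \in S(E_\varepsilon)$ is (with a suitable labelling of $\xi_1,\xi_2$): S6 (one-sided chain singularity): if $\xi_1=\xi_2$ and there is a sequence $(x_n) \subset S(E_\varepsilon)\setminus\{x\}$ with $x_n\to x$ and asymptotically opposite contributors. S7 (chain-chain singularity): if $\xi_1=-\xi_2$ and for each $i\in\{1,2\}$ there are $\delta_i>0$ and a sequence in $U_{\delta_i}(x,\xi_i)\cap S(E_\varepsilon)$ converging to $x$ with asymptotically opposite contributors. S8 (sharp-chain singularity): if $\xi_1=-\xi_2$, there is $\delta_1>0$ for which $U_{\delta_1}(x,\xi_1)\setminus E_\varepsilon$ is connected, and there are $\delta_2>0$ and a sequence in $U_{\delta_2}(x,\xi_2)\cap S(E_\varepsilon)$ converging to $x$ with asymptotically opposite contributors. The set of chain singularities is $\mathcal{C}(\partial E_\varepsilon) := \{x \in \partial E_\varepsilon : x \text{ is of type S6, S7 or S8}\}$. *)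

(* Defs.v *)
From HB Require Import structures.
From mathcomp Require Export all_boot all_order all_algebra.
From mathcomp Require Export all_classical all_reals all_analysis.
Export numFieldNormedType.Exports.
Export Order.TTheory GRing.Theory Num.Theory.

Set Implicit Arguments.
Unset Strict Implicit.
Unset Printing Implicit Defensive.

Local Open Scope classical_set_scope.
Local Open Scope ring_scope.

(* The plane is 'rV[R]_2. Its library norm `|x| is the max norm, so the        *)
(* Euclidean inner product, norm and balls are introduced here; the library    *)
(* topology of 'rV[R]_2 (used for closure, interior, compact, connected and    *)
(* convergence) is the usual one, as all norms on the plane are equivalent.    *)

Definition edot (R : realType) (u v : 'rV[R]_2) : R :=
  \sum_(i < 2) u ord0 i * v ord0 i.

Definition enorm (R : realType) (u : 'rV[R]_2) : R := Num.sqrt (edot u u).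

Definition eball (R : realType) (x : 'rV[R]_2) (r : R) : set 'rV[R]_2 :=
  [set z | enorm (z - x) < r].

Definition half_eball (R : realType) (x : 'rV[R]_2) (r : R) (v : 'rV[R]_2) :
    set 'rV[R]_2 :=
  [set z | eball x r z /\ 0 < edot (z - x) v].

Definition boundary (T : topologicalType) (A : set T) : set T :=
  closure A `\` interior A.

Section Neighbourhood.
Variables (R : realType) (E : set 'rV[R]_2) (eps : R).

Definition fattening : set 'rV[R]_2 := closure (\bigcup_(p in E) eball p eps).

Definition contributors (x : 'rV[R]_2) : set 'rV[R]_2 :=
  [set y | boundary E y /\ enorm (y - x) = eps].

Definition unique_contributor_points : set 'rV[R]_2 :=
  [set x | boundary fattening x /\ exists y, contributors x = [set y]].

Definition smooth_point (x : 'rV[R]_2) : Prop :=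
  boundary fattening x /\
  exists2 r : R, 0 < r &
    boundary fattening `&` eball x r `<=` unique_contributor_points.

Definition singularities : set 'rV[R]_2 :=
  [set x | boundary fattening x /\ ~ smooth_point x].

Definition outward_directions (x : 'rV[R]_2) : set 'rV[R]_2 :=
  [set xi | enorm xi = 1 /\
    exists u : nat -> 'rV[R]_2,
      [/\ forall n, ~ fattening (u n),
          u @ \oo --> x &
          (fun n => (enorm (u n - x))^-1 *: (u n - x)) @ \oo --> xi]].

Definition extremal_directions (x : 'rV[R]_2) : set 'rV[R]_2 :=
  [set xi | outward_directions x xi /\
    exists2 y, contributors x y & edot (y - x) xi = 0].

Definition extremal_contributors (x : 'rV[R]_2) : set 'rV[R]_2 :=
  [set y | contributors x y /\
    exists2 xi, outward_directions x xi & edot (y - x) xi = 0].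

(* y1 n and y2 n may coincide, in which case their set is a singleton. *)
Definition asymptotically_opposite (u : nat -> 'rV[R]_2) : Prop :=
  exists y1 y2 : nat -> 'rV[R]_2,
    (forall n, extremal_contributors (u n) = [set y1 n; y2 n]) /\
    (fun n => edot (eps^-1 *: (y1 n - u n)) (eps^-1 *: (y2 n - u n)))
      @ \oo --> (-1 : R).

Definition chain_towards (x : 'rV[R]_2) (A : set 'rV[R]_2) : Prop :=
  exists u : nat -> 'rV[R]_2,
    [/\ forall n, (A `&` singularities) (u n),
        u @ \oo --> x &
        asymptotically_opposite u].

(* In the three types below, "exists xi1 xi2" over both orderings of the set   *)
(* of extremal directions is the choice of a suitable labelling.               *)

Definition one_sided_chain (x : 'rV[R]_2) : Prop :=
  singularities x /\
  exists xi1 xi2 : 'rV[R]_2,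
    [/\ extremal_directions x = [set xi1; xi2],
        xi1 = xi2 &
        chain_towards x (~` [set x])].

Definition chain_chain (x : 'rV[R]_2) : Prop :=
  singularities x /\
  exists xi1 xi2 : 'rV[R]_2,
    [/\ extremal_directions x = [set xi1; xi2],
        xi1 = - xi2,
        exists2 d1 : R, 0 < d1 & chain_towards x (half_eball x d1 xi1) &
        exists2 d2 : R, 0 < d2 & chain_towards x (half_eball x d2 xi2)].

Definition sharp_chain (x : 'rV[R]_2) : Prop :=
  singularities x /\
  exists xi1 xi2 : 'rV[R]_2,
    [/\ extremal_directions x = [set xi1; xi2],
        xi1 = - xi2,
        exists2 d1 : R, 0 < d1 & connected (half_eball x d1 xi1 `\` fattening) &
        exists2 d2 : R, 0 < d2 & chain_towards x (half_eball x d2 xi2)].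

Definition chain_singularities : set 'rV[R]_2 :=
  [set x | boundary fattening x /\
    [\/ one_sided_chain x, chain_chain x | sharp_chain x]].

End Neighbourhood.

(* Main.v *)
Require Import Defs.
From mathcomp Require Import lra ring.
Set Implicit Arguments.
Unset Strict Implicit.
Unset Printing Implicit Defensive.
Local Open Scope classical_set_scope.
Local Open Scope ring_scope.

(* A limit [x] of points with almost opposite extremal contributors has two
   opposite contributors [x + eps n], [x - eps n], so that near [x] the
   complement of the fattening lies in two thin cusps tangent to a direction
   [xi] and to [- xi]. Assume that the cusp at [xi] contains complement points,
   or merely boundary points, arbitrarily close to [x]. Then all points of [E]
   near distance [eps] from small cusp points lie near [x + eps n] or
   [x - eps n], and the fattening meets each small circular arc of the cusp in
   an upper part and a lower part. Hence:
   - if no small arc is contained in the fattening ("full"), the complement in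
     the cusp fibres over its radii with arcs as fibres, so it is connected;
   - otherwise full arcs exist at all scales, and the complement comes to an end
     at the first full arc beyond any given complement point; it ends at a
     singularity whose extremal contributors are almost opposite.
   Closedness: a limit [x] of chain singularities inherits a chain from the side
   on which they come, and the other side is empty, connected or a chain.
   Total disconnectedness: an arc through a point with two opposite contributors
   is full, so a nondegenerate connected set of such points would make all small
   arcs on one side full, and leave no boundary point there. *)

(** * Euclidean geometry of the plane *)

Section EuclideanPlane.
Variable R : realType.
Implicit Types (u v w x y z : 'rV[R]_2) (a r : R).

Lemma edotE u v : edot u v =
  u ord0 ord0 * v ord0 ord0 + u ord0 (lift ord0 ord0) * v ord0 (lift ord0 ord0).
Proof. by rewrite /edot !big_ord_recl big_ord0 addr0. Qed.

Lemma edotC u v : edot u v = edot v u.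
Proof. by rewrite !edotE; ring. Qed.

Lemma edotDl u v w : edot (u + v) w = edot u w + edot v w.
Proof. by rewrite !edotE !mxE; ring. Qed.

Lemma edotNl u w : edot (- u) w = - edot u w.
Proof. by rewrite !edotE !mxE; ring. Qed.

Lemma edotZl a u w : edot (a *: u) w = a * edot u w.
Proof. by rewrite !edotE !mxE; ring. Qed.

Lemma edotDr u v w : edot w (u + v) = edot w u + edot w v.
Proof. by rewrite !(edotC w) edotDl. Qed.

Lemma edotNr u w : edot w (- u) = - edot w u.
Proof. by rewrite !(edotC w) edotNl. Qed.

Lemma edotZr a u w : edot w (a *: u) = a * edot w u.
Proof. by rewrite !(edotC w) edotZl. Qed.

Lemma edot0l w : edot 0 w = 0.
Proof. by rewrite !edotE !mxE; ring. Qed.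

Definition edot_linear :=
  (edotDl, edotDr, edotNl, edotNr, edotZl, edotZr, edot0l).

Lemma edot_sqrD u v :
  edot (u + v) (u + v) = edot u u + edot u v *+ 2 + edot v v.
Proof. by rewrite !edotE !mxE; ring. Qed.

Lemma edot_sqrB u v :
  edot (u - v) (u - v) = edot u u - edot u v *+ 2 + edot v v.
Proof. by rewrite !edotE !mxE; ring. Qed.

Lemma edot_ge0 u : 0 <= edot u u.
Proof. by rewrite edotE -!expr2 addr_ge0 // sqr_ge0. Qed.

Lemma edot_eq0 u : edot u u = 0 -> u = 0.
Proof.
rewrite edotE -!expr2 => /eqP.
rewrite paddr_eq0 ?sqr_ge0 // !sqrf_eq0 => /andP[/eqP u0 /eqP u1].
apply/rowP => i; rewrite mxE.
by case: (unliftP ord0 i) => [j ->|->] //; rewrite ord1.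
Qed.

Lemma edot_sqr_le u v : edot u v ^+ 2 <= edot u u * edot v v.
Proof.
rewrite !edotE.
set a := u _ _; set b := u _ _; set c := v _ _; set d := v _ _.
rewrite -subr_ge0.
by rewrite [X in 0 <= X](_ : _ = (a * d - b * c) ^+ 2) ?sqr_ge0 //; ring.
Qed.

Lemma enorm_ge0 u : 0 <= enorm u.
Proof. exact: sqrtr_ge0. Qed.

Lemma enorm_sqr u : enorm u ^+ 2 = edot u u.
Proof. by rewrite sqr_sqrtr // edot_ge0. Qed.

Lemma enorm_le u r : 0 <= r -> (enorm u <= r) = (edot u u <= r ^+ 2).
Proof. by move=> r0; rewrite -enorm_sqr ler_sqr ?nnegrE ?enorm_ge0. Qed.

Lemma enorm_lt u r : 0 <= r -> (enorm u < r) = (edot u u < r ^+ 2).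
Proof. by move=> r0; rewrite -enorm_sqr ltr_sqr ?nnegrE ?enorm_ge0. Qed.

Lemma enorm_ge u r : 0 <= r -> (r <= enorm u) = (r ^+ 2 <= edot u u).
Proof. by move=> r0; rewrite leNgt enorm_lt // -leNgt. Qed.

Lemma enorm_gt u r : 0 <= r -> (r < enorm u) = (r ^+ 2 < edot u u).
Proof. by move=> r0; rewrite ltNge enorm_le // -ltNge. Qed.

Lemma enorm_eq u r : 0 <= r -> enorm u = r <-> edot u u = r ^+ 2.
Proof.
move=> r0; rewrite -enorm_sqr; split=> [->//|/eqP].
by rewrite eqrXn2 ?enorm_ge0 // => /eqP.
Qed.

Lemma edot_le_enorm u v : edot u v <= enorm u * enorm v.
Proof.
apply: (le_trans (ler_norm _)).
rewrite -ler_sqr ?nnegrE ?mulr_ge0 ?enorm_ge0 //.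
by rewrite real_normK ?num_real // exprMn !enorm_sqr edot_sqr_le.
Qed.

Lemma enormN u : enorm (- u) = enorm u.
Proof. by rewrite /enorm !edot_linear opprK. Qed.

Lemma enormB u v : enorm (u - v) = enorm (v - u).
Proof. by rewrite -enormN opprB. Qed.

Lemma enorm0 : enorm (0 : 'rV[R]_2) = 0.
Proof. by rewrite /enorm edot0l sqrtr0. Qed.

Lemma enorm_gt0 u : (0 < enorm u) = (u != 0).
Proof.
rewrite lt_def enorm_ge0 andbT; congr negb; apply/eqP/eqP => [u0|->].
  by apply: edot_eq0; rewrite -enorm_sqr u0 expr0n.
exact: enorm0.
Qed.

Lemma enormZ a u : enorm (a *: u) = `|a| * enorm u.
Proof.
by rewrite /enorm !edot_linear mulrA -expr2 sqrtrM ?sqr_ge0 // sqrtr_sqr.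
Qed.

Lemma enormD u v : enorm (u + v) <= enorm u + enorm v.
Proof.
rewrite enorm_le ?addr_ge0 ?enorm_ge0 // !edot_linear sqrrD !enorm_sqr.
have := edot_le_enorm u v; rewrite (edotC v u) => h.
set e := edot u v in h *; lra.
Qed.

Lemma enorm_triangle x y z : enorm (x - z) <= enorm (x - y) + enorm (y - z).
Proof. by rewrite -[x - z](subrKA y) enormD. Qed.

Lemma coord_le_enorm u i : `|u ord0 i| <= enorm u.
Proof.
rewrite -ler_sqr ?nnegrE ?enorm_ge0 // real_normK ?num_real // enorm_sqr edotE.
rewrite -!expr2.
case: (unliftP ord0 i) => [j ->|->]; last by rewrite lerDl sqr_ge0.
by rewrite (ord1 j) lerDr sqr_ge0.
Qed.

Lemma continuous_edot (T : topologicalType) (f g : T -> 'rV[R]_2) (t : T) :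
  {for t, continuous f} -> {for t, continuous g} ->
  {for t, continuous (fun s => edot (f s) (g s))}.
Proof.
move=> cf cg; rewrite /prop_for /= /continuous_at edotE.
under eq_fun do rewrite edotE.
have cc (h : T -> 'rV[R]_2) j : {for t, continuous h} ->
    (fun s => h s ord0 j) @ t --> h t ord0 j.
  by move=> ch; apply: (@cvg_comp _ _ _ h (fun M : 'rV[R]_2 => M ord0 j) _ _ _ ch); exact: coord_continuous.
by apply: cvgD; apply: cvgM; apply: cc.
Qed.

Lemma continuous_enorm (T : topologicalType) (f : T -> 'rV[R]_2) (t : T) :
  {for t, continuous f} -> {for t, continuous (fun s => enorm (f s))}.
Proof.
move=> cf; apply: (@continuous_comp _ _ _ (fun s => edot (f s) (f s)) Num.sqrt).
  exact: continuous_edot.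
exact: sqrt_continuous.
Qed.

(** The library balls are those of the max norm: coordinates are bounded by [enorm] for one
    direction, and continuity of [enorm] gives the other. *)
Lemma nbhs_eballP x (A : set 'rV[R]_2) :
  nbhs x A <-> exists2 r, 0 < r & eball x r `<=` A.
Proof.
split=> [/nbhs_ballP[r /= r0 rA]|[r r0 rA]].
  exists r => // y xyr; apply: rA; split=> // i j; rewrite (ord1 i) /ball /=.
  apply: le_lt_trans xyr; rewrite enormB.
  by have := coord_le_enorm (x - y) j; rewrite !mxE.
apply: filterS rA _.
have c : {for x, continuous (fun y => enorm (y - x))}.
  apply: continuous_enorm; apply: continuousB => //; exact: cst_continuous.
have : nbhs (enorm (x - x)) [set s | s < r].
  by rewrite subrr enorm0; exact: lt_nbhsl.
by move/c.
Qed.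

Lemma nbhs_eball x r : 0 < r -> nbhs x (eball x r).
Proof. by move=> r0; apply/nbhs_eballP; exists r. Qed.

Lemma closure_eballP (A : set 'rV[R]_2) x :
  closure A x <-> forall r, 0 < r -> exists2 y, A y & enorm (y - x) < r.
Proof.
split=> [cAx r r0|h B /nbhs_eballP[r r0 rB]].
  by have [y [Ay ry]] := cAx _ (nbhs_eball _ r0); exists y.
by have [y Ay yr] := h r r0; exists y; split=> //; apply: rB.
Qed.

Lemma cvg_enormP (u_ : nat -> 'rV[R]_2) x :
  u_ @ \oo --> x <->
  forall r, 0 < r -> \forall k \near \oo, enorm (u_ k - x) < r.
Proof.
split=> [ux r r0|h A /nbhs_eballP[r r0 rA]].
  exact: (ux _ (nbhs_eball _ r0)).
by have := h r r0; apply: filterS => k; exact: rA.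
Qed.

Lemma compact_enorm_le x r : compact [set y | enorm (y - x) <= r].
Proof.
apply: bounded_closed_compact.
  exists (enorm x + r); split; first exact: num_real.
  move=> M xrM y /= yx; apply: le_trans (ltW xrM).
  rewrite [leLHS]/Num.norm /= mx_normrE.
  have yxr : enorm y <= enorm x + r.
    by have := enorm_triangle y x 0; rewrite !subr0; lra.
  apply: bigmax_le => [|[i j] _]; first by apply: le_trans yxr; exact: enorm_ge0.
  by rewrite (ord1 i); apply: le_trans yxr; exact: coord_le_enorm.
apply: (preimage_closed (f := fun y => enorm (y - x))) (@closed_le _ r).
by move=> y _; apply: (continuous_enorm (f := fun y => y - x));
  apply: continuousB => //; exact: cst_continuous.
Qed.

(** The minimum over a compact set is attained, so a strict lower bound has a uniform gap.
    Compactness of [E] is used mainly in this form. *)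
Lemma compact_gt_bound (T : topologicalType) (A : set T) (f : T -> R) a :
  compact A -> continuous f -> (forall t, A t -> a < f t) ->
  exists2 r, 0 < r & forall t, A t -> a + r <= f t.
Proof.
move=> cA cf af; have [->|/set0P A0] := eqVneq A set0; first by exists 1.
have [|t /set_mem At tmin] := compact_EVT_min A0 cA (f := f).
  exact: continuous_subspaceT.
exists (f t - a); first by rewrite subr_gt0 af.
by move=> s As; rewrite addrC subrK; apply: tmin; apply: mem_set.
Qed.

Lemma invS_lt r : 0 < r -> \forall k \near \oo, k.+1%:R^-1 < r.
Proof.
move=> r0; have := @cvg_harmonic R.
move/(_ _ (lt_nbhsl r0)); exact.
Qed.

End EuclideanPlane.

(** * The fattening and its outward directions *)

Section Fattening.
Variables (R : realType) (E : set 'rV[R]_2) (eps : R).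
Hypotheses (compact_E : compact E) (eps_gt0 : 0 < eps).
Implicit Types (u v w x y z p xi : 'rV[R]_2) (r s : R).

Local Notation F := (fattening E eps).

Lemma continuous_enormB x : continuous (fun y : 'rV[R]_2 => enorm (y - x)).
Proof.
move=> y; apply: (continuous_enorm (f := fun p => p - x)).
by apply: continuousB => //; exact: cst_continuous.
Qed.

Lemma continuous_edotB x w : continuous (fun y : 'rV[R]_2 => edot (y - x) w).
Proof.
move=> y; apply: (continuous_edot (f := fun p => p - x) (g := fun=> w));
  last exact: cst_continuous.
by apply: continuousB => //; exact: cst_continuous.
Qed.

Lemma closed_E : closed E.
Proof. exact: compact_closed (@norm_hausdorff _ _) compact_E. Qed.

Lemma segmentE y p s : y - (p + s *: (y - p)) = (1 - s) *: (y - p).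
Proof. by rewrite scalerBl scale1r opprD addrA. Qed.

Lemma fatteningP p : F p <-> exists2 y, E y & enorm (y - p) <= eps.
Proof.
split=> [cFp|[y Ey yp]].
  apply: contrapT => h.
  have [y Ey|r r0 rE] := compact_gt_bound (a := eps) compact_E (@continuous_enormB p).
    by rewrite ltNge; apply/negP => yp; apply: h; exists y.
  have /closure_eballP/(_ r r0)[q [y Ey yq] qp] := cFp.
  have := rE y Ey; have := enorm_triangle y q p.
  move: yq; rewrite /eball /= (enormB q y); lra.
apply/closure_eballP => r r0.
have yp0 : 0 < enorm (y - p) + 1 by have := enorm_ge0 (y - p); lra.
(* The fraction of the way from [p] to [y]; adding 1 avoids a zero denominator when [y = p]. *)
pose s := Num.min (1 / 2) (r / 2 / (enorm (y - p) + 1)).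
have s0 : 0 < s by rewrite lt_min !divr_gt0.
have s1 : s <= 1 / 2 by rewrite ge_min lexx.
have sr : s * (enorm (y - p) + 1) <= r / 2.
  by rewrite -ler_pdivlMr // ge_min lexx orbT.
exists (p + s *: (y - p)).
  exists y => //; rewrite /eball /= enormB segmentE enormZ ger0_norm; last by lra.
  have h1 : 0 < s * eps by rewrite mulr_gt0.
  have h2 : 0 <= (1 - s) * (eps - enorm (y - p)) by apply: mulr_ge0; lra.
  lra.
rewrite addrC addKr enormZ gtr0_norm //; lra.
Qed.

Lemma nfatteningP p : ~ F p <-> forall y, E y -> eps < enorm (y - p).
Proof.
rewrite fatteningP; split=> [h y Ey|h [y Ey]].
  by rewrite ltNge; apply/negP => yp; apply: h; exists y.
by rewrite leNgt h.
Qed.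

Lemma closed_fattening : closed F.
Proof. exact: closed_closure. Qed.

Lemma boundary_fatteningP x : boundary F x <-> F x /\ closure (~` F) x.
Proof.
by rewrite /boundary -(proj1 (closure_id _) closed_fattening) closure_setC setDE.
Qed.

Lemma closureC_dist x y : closure (~` F) x -> E y -> eps <= enorm (y - x).
Proof.
move=> /closure_eballP cx Ey; apply/ler_addgt0Pr => r r0.
have [p /nfatteningP/(_ y Ey) py px] := cx r r0.
have := enorm_triangle y x p; rewrite (enormB x p); lra.
Qed.

Lemma boundary_dist x y : boundary F x -> E y -> eps <= enorm (y - x).
Proof. by move=> /boundary_fatteningP[_ /closureC_dist]; apply. Qed.

Lemma boundary_fattening_closed x :
  (forall r, 0 < r -> exists2 y, boundary F y & enorm (y - x) < r) ->
  boundary F x.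
Proof.
move=> h; apply/boundary_fatteningP; split.
  apply: closed_fattening; apply/closure_eballP => r /h[y].
  by move=> /boundary_fatteningP[Fy _]; exists y.
apply: closed_closure; apply/closure_eballP => r /h[y].
by move=> /boundary_fatteningP[_ Fy]; exists y.
Qed.

(** If a point [y] of [E] at distance [eps] were interior to [E], a small step from [y] towards [x]
    would give a point of [E] closer than [eps]. *)
Lemma contributorsP x y : boundary F x ->
  contributors E eps x y <-> E y /\ enorm (y - x) = eps.
Proof.
move=> bx; split=> [[[cy _] yx]|[Ey yx]]; first by split=> //; exact: closed_E cy.
split=> //; split; first exact: subset_closure.
move=> /nbhs_eballP[r r0 rE].
pose s := Num.min (1 / 2) (r / 2 / eps).
have s0 : 0 < s by rewrite lt_min !divr_gt0.
have s1 : s <= 1 / 2 by rewrite ge_min lexx.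
have sr : s * eps <= r / 2 by rewrite -ler_pdivlMr // ge_min lexx orbT.
have /(boundary_dist bx) : E (y + s *: (x - y)).
  apply: rE; rewrite /eball /= addrC addKr enormZ gtr0_norm // enormB yx; nra.
rewrite enormB segmentE enormZ enormB yx ger0_norm; last by lra.
have := mulr_gt0 s0 eps_gt0; lra.
Qed.

Lemma exists_contributor x : boundary F x -> exists y, contributors E eps x y.
Proof.
move=> bx; have /boundary_fatteningP[/fatteningP[y Ey yx] _] := bx.
exists y; apply/contributorsP => //; split=> //.
by apply/eqP; rewrite eq_le yx boundary_dist.
Qed.

(** Points of [E] with nonnegative inner product are not contributors, so by compactness they keep a
    distance above [eps] after a small step. From all other points the step along [w] moves away. *)
Lemma exists_step_out x w : boundary F x ->
  (forall y, contributors E eps x y -> edot (y - x) w < 0) ->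
  exists2 s0, 0 < s0 & forall s, 0 < s -> s <= s0 -> ~ F (x + s *: w).
Proof.
move=> bx wx.
have cE' : compact (E `&` [set y | 0 <= edot (y - x) w]).
  apply: compact_closedI => //.
  apply: (preimage_closed (f := fun y => edot (y - x) w)) (@closed_ge _ 0).
  by move=> y _; exact: continuous_edotB.
have [y [Ey /= yw]|r r0 rE] :=
    compact_gt_bound (a := eps) cE' (@continuous_enormB x).
  rewrite lt_def boundary_dist // andbT; apply/eqP => yx.
  by have := wx y; rewrite ltNge yw => H; apply: (negP (H _)) => //; apply/contributorsP.
have w0 : 0 < enorm w + 1 by have := enorm_ge0 w; lra.
exists (r / 2 / (enorm w + 1)); first by rewrite !divr_gt0.
move=> s s0; rewrite ler_pdivlMr // => sr.
apply/nfatteningP => y Ey.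
have [yw|yw] := leP 0 (edot (y - x) w).
  have := rE y (conj Ey yw); have := enorm_triangle y (x + s *: w) x.
  rewrite [x + _ - x]addrC addKr enormZ gtr0_norm //; nra.
rewrite enorm_gt; last exact: ltW.
rewrite opprD addrA.
have := boundary_dist bx Ey; rewrite enorm_ge; last exact: ltW.
move: yw (mulr_ge0 (sqr_ge0 s) (edot_ge0 w)).
rewrite !edot_linear (edotC w y) (edotC w x) => yw sw.
have := mulr_gt0 s0 (_ : 0 < - (edot y w - edot x w)); lra.
Qed.

Lemma outward_directionsP x xi :
  outward_directions E eps x xi <->
  enorm xi = 1 /\ forall r, 0 < r -> exists p,
    [/\ ~ F p, enorm (p - x) < r &
        enorm ((enorm (p - x))^-1 *: (p - x) - xi) < r].
Proof.
split=> [[xi1 [u [Fu ux uxi]]]|[xi1 h]]; split=> //.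
  move=> r r0; move/cvg_enormP: ux => /(_ r r0) ux.
  move/cvg_enormP: uxi => /(_ r r0) uxi.
  by have [k [? ?]] := filter_ex (filterI ux uxi); exists (u k); split.
have /choice[u hu] k := h k.+1%:R^-1 (ltac:(by rewrite invr_gt0 ltr0Sn)).
exists u; split; first by move=> k; have [] := hu k.
  apply/cvg_enormP => r r0; have := invS_lt r0; apply: filterS => k.
  by have [_ + _] := hu k; exact: lt_trans.
apply/cvg_enormP => r r0; have := invS_lt r0; apply: filterS => k.
by have [_ _] := hu k; exact: lt_trans.
Qed.

Lemma nfattening_edot x y p : boundary F x -> contributors E eps x y -> ~ F p ->
  edot (y - x) (p - x) < enorm (p - x) ^+ 2 / 2.
Proof.
move=> bx /(contributorsP _ bx)[Ey yx] /nfatteningP/(_ y Ey).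
rewrite enorm_gt; last exact: ltW.
have -> : y - p = (y - x) - (p - x) by rewrite opprB addrA subrK.
have := enorm_sqr (y - x); rewrite yx enorm_sqr.
move: (y - x) (p - x) => u v ->; rewrite !edot_linear (edotC v u); lra.
Qed.

(** Divide the inequality of [nfattening_edot] by [enorm (p - x)] and let [p] tend to [x] in the
    direction [xi]. *)
Lemma outward_le0 x y xi : boundary F x -> contributors E eps x y ->
  outward_directions E eps x xi -> edot (y - x) xi <= 0.
Proof.
move=> bx yx /outward_directionsP[xi1 h].
have [_ e] := (contributorsP _ bx).1 yx.
rewrite leNgt; apply/negP; set a := edot _ _ => a0.
(* With tolerance [t = a / (1 + eps)], the quadratic term costs at most [t / 2] and the error of the
   direction at most [eps * t], together less than [a]. *)
have [|p [Fp]] := h (a / (1 + eps)); first by rewrite divr_gt0 // addr_gt0.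
have := nfattening_edot bx yx Fp.
set n := enorm (p - x); set q := p - x => npq nr.
have n0 : 0 < n.
  rewrite lt_def enorm_ge0 andbT; apply/eqP => n0.
  move: npq; have -> : q = 0 by apply: edot_eq0; rewrite -enorm_sqr -/n n0 expr0n.
  by rewrite edotC edot0l n0 expr0n mul0r ltxx.
move=> qr.
have h1 : edot (y - x) (n^-1 *: q) < n / 2.
  rewrite edotZr mulrC ltr_pdivrMr //; lra.
have h2 := edot_le_enorm (y - x) (xi - n^-1 *: q).
rewrite e edotDr edotNr enormB -/a in h2.
have h3 : eps * enorm (n^-1 *: q - xi) <= eps * (a / (1 + eps)).
  by rewrite ler_pM2l // ltW.
have h4 : a = a / (1 + eps) + eps * (a / (1 + eps)).
  by field; rewrite gt_eqF // addr_gt0.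
lra.
Qed.

(** The directions from [x] to nearby complement points form a proper filter on the compact unit
    circle; any cluster point is an outward direction. *)
Lemma exists_outward x : boundary F x -> exists xi, outward_directions E eps x xi.
Proof.
move=> bx; have /boundary_fatteningP[Fx cx] := bx.
pose dir p := (enorm (p - x))^-1 *: (p - x).
pose G := dir @ within (~` F) (nbhs x).
have PG : ProperFilter G.
  by apply: fmap_proper_filter; exact: within_nbhs_proper.
have dir1 p : ~ F p -> enorm (dir p) = 1.
  move=> Fp; rewrite enormZ gtr0_norm ?invr_gt0 ?mulVf //.
    by rewrite gt_eqF // enorm_gt0 subr_eq0; apply: contra_notN Fp => /eqP ->.
  by rewrite enorm_gt0 subr_eq0; apply: contra_notN Fp => /eqP ->.
have cS : compact [set xi : 'rV[R]_2 | enorm xi = 1].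
  apply: (@subclosed_compact _ _ [set y | enorm (y - 0) <= 1]).
  - apply: (preimage_closed (f := @enorm R)) (@closed_eq _ 1).
    by move=> y _; apply: (continuous_enorm (f := id)).
  - exact: compact_enorm_le.
  - by move=> u /= u1; rewrite subr0 u1.
have [|xi [xi1 cxi]] := cS G PG.
  rewrite /G /fmap /=; near=> p.
  apply: dir1; near: p; exact: withinT.
exists xi; apply/outward_directionsP => //; split=> // r r0.
have [| | q [[p [Fp pr] <-] qr]] :=
  cxi (dir @` ((~` F) `&` eball x r)) (eball xi r); last by exists p; split.
  rewrite /G /fmap /=; near=> p; exists p => //; split; near: p.
    exact: withinT.
  exact/cvg_within/nbhs_eball.
exact: nbhs_eball.
Unshelve. all: by end_near.
Qed.
End Fattening.

(** * Extremal contributors *)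

Section HalfCircle.
Variables (R : realType) (e : R).
Hypothesis e_gt0 : 0 < e.
Implicit Types (a p : R).

(** On a half circle with [a >= 0], the sign of the determinant gives the order by angle, which is
    the order of the coordinate [p]. *)
Lemma half_circle_cross a p a' p' : 0 <= a -> 0 <= a' ->
  a ^+ 2 + p ^+ 2 = e ^+ 2 -> a' ^+ 2 + p' ^+ 2 = e ^+ 2 -> p' <= p ->
  a * p' <= p * a'.
Proof.
move=> a0 a'0 ap ap' pp.
have [p0|p0] := leP 0 p.
  have [p'0|p'0] := leP p' 0.
    have := mulr_ge0 p0 a'0; have := mulr_ge0 a0 (_ : 0 <= - p'); lra.
  have aa : a <= a'.
    rewrite -ler_sqr ?nnegrE // -(lerD2r (p ^+ 2)) ap -ap' lerD2l.
    by rewrite ler_sqr ?nnegrE ?(ltW p'0).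
  by rewrite [leRHS]mulrC ler_pM // ltW.
have aa : a' <= a.
  rewrite -ler_sqr ?nnegrE // -(lerD2r (p' ^+ 2)) ap' -ap lerD2l.
  rewrite -sqrrN -(sqrrN p') ler_sqr ?nnegrE; lra.
have : a' * - p <= a * - p' by rewrite ler_pM //; lra.
lra.
Qed.

(** Parallel vectors of equal length are equal or opposite; on the closed half circle opposite ones
    are the ends of the diameter. *)
Lemma half_circle_cross0 a p a' p' : 0 <= a -> 0 <= a' ->
  a ^+ 2 + p ^+ 2 = e ^+ 2 -> a' ^+ 2 + p' ^+ 2 = e ^+ 2 -> p' <= p ->
  a * p' = p * a' -> p = p' \/ [/\ a = 0, a' = 0, p = e & p' = - e].
Proof.
move=> a0 a'0 ap ap' pp cr.
have h : e ^+ 2 * a ^+ 2 = e ^+ 2 * a' ^+ 2.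
  rewrite -{1}ap' -ap !mulrDl [X in _ + X](_ : _ = (a * p') ^+ 2); last by ring.
  by rewrite cr; ring.
have aa : a = a'.
  apply/eqP; rewrite -(eqrXn2 (n := 2)) //; apply/eqP; apply: mulfI h.
  by rewrite expf_eq0 /= gt_eqF.
have : (p - p') * (p + p') = 0.
  by apply/eqP; rewrite -subr_sqr subr_eq0 -(inj_eq (addrI (a ^+ 2))) ap {1}aa ap'.
move=> /eqP; rewrite mulf_eq0 => /orP[|] /eqP pp0; first by left; lra.
have : a' * (p - p') = 0 by move: cr; rewrite mulrBr aa; lra.
move/eqP; rewrite mulf_eq0 => /orP[|] /eqP h0; last by left; lra.
right; have pe : p ^+ 2 = e ^+ 2 by rewrite -ap aa h0 expr0n add0r.
have p0 : 0 <= p by lra.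
have -> : p = e by apply/eqP; rewrite -(eqrXn2 (n := 2)) // ?pe // ltW.
have : p = e by apply/eqP; rewrite -(eqrXn2 (n := 2)) // ?pe // ltW.
by split=> //; lra.
Qed.

(** Moving away from a fixed point along the half circle widens the angle. Multiplied by [a + a'],
    the claim becomes [p - p'] times the sum of two determinant inequalities. *)
Lemma half_circle_dot a p a' p' a'' p'' : 0 <= a -> 0 <= a' -> 0 <= a'' ->
  a ^+ 2 + p ^+ 2 = e ^+ 2 -> a' ^+ 2 + p' ^+ 2 = e ^+ 2 ->
  a'' ^+ 2 + p'' ^+ 2 = e ^+ 2 -> p'' <= p' -> p' <= p ->
  a * a'' + p * p'' <= a' * a'' + p' * p''.
Proof.
move=> a0 a'0 a''0 ap ap' ap'' p1 p2.
have c1 := half_circle_cross a0 a''0 ap ap'' (le_trans p1 p2).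
have c2 := half_circle_cross a'0 a''0 ap' ap'' p1.
have ident : (a' - a) * (a + a') = (p - p') * (p + p').
  have : a ^+ 2 + p ^+ 2 = a' ^+ 2 + p' ^+ 2 by rewrite ap.
  move=> {}ident; lra.
have key : (a + a') * ((p - p') * p'') <= (a + a') * ((a' - a) * a'').
  have -> : (a + a') * ((a' - a) * a'') = (p - p') * ((p + p') * a'').
    by rewrite [RHS]mulrA -ident; ring.
  have -> : (a + a') * ((p - p') * p'') = (p - p') * ((a + a') * p'') by ring.
  by apply: ler_wpM2l; lra.
have [s0|s0] := eqVneq (a + a') 0; last first.
  have : 0 < a + a' by rewrite lt_def s0 addr_ge0.
  by move=> s1; move: key; rewrite ler_pM2l //; lra.
have az : a = 0 by lra.
have a'z : a' = 0 by lra.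
suff : (p - p') * p'' <= 0 by rewrite az a'z; lra.
have : (p - p') * (p + p') = 0 by rewrite -ident s0 mulr0.
move/eqP; rewrite mulf_eq0 => /orP[|] /eqP h; first by rewrite h mul0r.
apply: mulr_ge0_le0; lra.
Qed.
End HalfCircle.

(** * Rotation by a right angle and planar frame identities *)

Section Perp.
Variable R : realType.
Implicit Types (u v w xi : 'rV[R]_2).

(** Rotation by a right angle, so that [edot (perp u) v] is the determinant of [u] and [v]. *)
Definition perp u : 'rV[R]_2 :=
  \row_i if i == ord0 then - u ord0 (lift ord0 ord0) else u ord0 ord0.

Lemma edot_perpl u v : edot (perp u) v =
  u ord0 ord0 * v ord0 (lift ord0 ord0) - u ord0 (lift ord0 ord0) * v ord0 ord0.
Proof. by rewrite edotE !mxE /=; ring. Qed.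

Lemma edot_perp u : edot (perp u) (perp u) = edot u u.
Proof. by rewrite !edotE !mxE /=; ring. Qed.

Lemma perp_orth u : edot u (perp u) = 0.
Proof. by rewrite !edotE !mxE /=; ring. Qed.

Lemma perpC u v : edot (perp u) v = - edot (perp v) u.
Proof. by rewrite !edot_perpl; ring. Qed.

Lemma edot_frame xi v w : edot v w * edot xi xi =
  edot v xi * edot w xi + edot v (perp xi) * edot w (perp xi).
Proof. by rewrite !edotE !mxE /=; ring. Qed.

Lemma perp_frame xi v w : edot (perp v) w * edot xi xi =
  edot v xi * edot w (perp xi) - edot v (perp xi) * edot w xi.
Proof. by rewrite !edotE !mxE /=; ring. Qed.

(** Cramer's rule without division, so that dependent [v1] and [v2] are allowed. *)
Lemma perp_cramer v1 v2 v :
  edot (perp v1) v2 *: v = edot (perp v) v2 *: v1 + edot (perp v1) v *: v2.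
Proof.
apply/rowP => i; rewrite !mxE !edot_perpl.
case: (unliftP ord0 i) => [j ->|->]; last by ring.
by rewrite (ord1 j); ring.
Qed.
End Perp.

(** * Outward directions and the two ends of the arc of contributors *)

Section ExtremalContributors.
Variables (R : realType) (E : set 'rV[R]_2) (eps : R).
Hypotheses (compact_E : compact E) (eps_gt0 : 0 < eps).
Implicit Types (u v w x y z p xi : 'rV[R]_2) (r s : R).
Local Notation F := (fattening E eps).
Local Notation Pi := (contributors E eps).

Lemma normalize_dist w xi : enorm xi = 1 -> w != 0 ->
  enorm ((enorm w)^-1 *: w - xi) <= 2 * enorm (w - xi).
Proof.
move=> xi1; rewrite -enorm_gt0 => w0.
have h : enorm ((enorm w)^-1 *: w - w) = `|1 - enorm w|.
  rewrite -{3}(scale1r w) -scalerBl enormZ -{2}(gtr0_norm w0) -normrM.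
  by rewrite mulrBl mulVf ?gt_eqF // mul1r.
apply: (le_trans (enorm_triangle _ w _)); rewrite h mulrDl !mul1r lerD2r.
have h1 := enorm_triangle w xi 0; have h2 := enorm_triangle xi w 0.
rewrite !subr0 xi1 in h1 h2; rewrite (enormB xi w) in h2.
rewrite ler_norml; lra.
Qed.

(** Tilting [xi] slightly towards [eta] makes all inner products with contributors negative, so
    small steps in the tilted direction leave the fattening. *)
Lemma outward_of_strict x xi eta : boundary F x -> enorm xi = 1 ->
  (forall y, Pi x y -> edot (y - x) xi <= 0) ->
  (forall y, Pi x y -> edot (y - x) eta < 0) ->
  outward_directions E eps x xi.
Proof.
move=> bx xi1 le0 lt0; apply/outward_directionsP; split=> // r r0.
have n0 : 0 < enorm eta + 1 by have := enorm_ge0 eta; lra.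
pose m := Num.min (1 / 2) (r / 4).
have m0 : 0 < m by rewrite lt_min !divr_gt0.
have m1 : m <= 1 / 2 by rewrite ge_min lexx.
have mr : m <= r / 4 by rewrite ge_min lexx orbT.
pose t := m / (enorm eta + 1).
have t0 : 0 < t by rewrite divr_gt0.
have tm : t * enorm eta <= m.
  by rewrite mulrAC ler_pdivrMr // ler_pM2l // lerDl.
pose w := xi + t *: eta.
have wxi : enorm (w - xi) <= m.
  by rewrite /w addrC addKr enormZ gtr0_norm.
have w0 : w != 0.
  rewrite -enorm_gt0; have := enorm_triangle xi w 0.
  by rewrite !subr0 xi1 enormB; lra.
have [y yx|s0 s00 hs] := exists_step_out compact_E eps_gt0 (w := w) bx.
  rewrite edotDr edotZr ltr_wnDl ?le0 // pmulr_rlt0 //; exact: lt0.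
have nw : 0 < enorm w by rewrite enorm_gt0.
pose s := Num.min s0 (r / 2 / enorm w).
have s1 : 0 < s by rewrite lt_min s00 !divr_gt0.
have s2 : s <= s0 by rewrite ge_min lexx.
have sr : s * enorm w <= r / 2 by rewrite -ler_pdivlMr // ge_min lexx orbT.
exists (x + s *: w); rewrite [x + _ - x]addrC addKr; split.
- exact: hs.
- by rewrite enormZ gtr0_norm //; lra.
- rewrite enormZ gtr0_norm // scalerA invfM mulrAC mulVf ?gt_eqF // mul1r.
  apply: le_lt_trans (normalize_dist xi1 w0) _; lra.
Qed.


Lemma compact_contributors x : boundary F x -> compact (Pi x).
Proof.
move=> bx; have -> : Pi x = E `&` [set y | enorm (y - x) = eps].
  by apply/seteqP; split=> y /contributorsP; exact.
apply: compact_closedI => //.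
apply: (preimage_closed (f := fun y => enorm (y - x))) (@closed_eq _ eps).
by move=> y _; exact: continuous_enormB.
Qed.

(* All contributors lie on a closed half circle; the extremal ones are its two
   end points, i.e. those with extreme coordinate along the diameter. *)
Lemma extremal_contributorsP x : boundary F x ->
  exists y1 y2, extremal_contributors E eps x = [set y1; y2] /\
    forall y y', Pi x y -> Pi x y' ->
      edot (y1 - x) (y2 - x) <= edot (y - x) (y' - x).
Proof.
move=> bx; have [xi0 out0] := exists_outward bx.
have xi01 : edot xi0 xi0 = 1 by rewrite -enorm_sqr (proj1 out0) expr1n.
(* Coordinates at [x]: [a] is measured against the outward direction [xi0], and [p] along the
   diameter of the half circle that holds all contributors. *)
pose a y := - edot (y - x) xi0; pose p y := edot (y - x) (perp xi0).
have a0 y : Pi x y -> 0 <= a y.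
  by move=> /(outward_le0 compact_E eps_gt0 bx)/(_ out0); rewrite oppr_ge0.
have dotE y y' : edot (y - x) (y' - x) = a y * a y' + p y * p y'.
  by rewrite -[LHS]mulr1 -xi01 edot_frame mulrNN.
have ap y : Pi x y -> a y ^+ 2 + p y ^+ 2 = eps ^+ 2.
  by move=> /(contributorsP compact_E eps_gt0 _ bx)[_ <-]; rewrite enorm_sqr dotE.
have crE y y' : edot (perp (y - x)) (y' - x) = p y * a y' - a y * p y'.
  by rewrite -[LHS]mulr1 -xi01 perp_frame /a /p; ring.
have pinj y y' : Pi x y -> Pi x y' -> p y = p y' -> y = y'.
  move=> Py Py' pp; have aa : a y = a y'.
    apply/eqP; rewrite -(eqrXn2 (n := 2)) ?a0 //; apply/eqP.
    by apply: (addIr (p y ^+ 2)); rewrite {2}pp !ap.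
  apply/eqP; rewrite -subr_eq0; apply/eqP/edot_eq0.
  have -> : y - y' = (y - x) - (y' - x) by rewrite opprB addrA subrK.
  by rewrite edot_sqrB !dotE aa pp; ring.
have [y0 Py0] := exists_contributor compact_E eps_gt0 bx.
have cp : {within Pi x, continuous p}.
  by apply: continuous_subspaceT; exact: continuous_edotB.
have [y1 /set_mem P1 max1] :=
  compact_EVT_max (ex_intro _ y0 Py0) (compact_contributors bx) cp.
have [y2 /set_mem P2 min2] :=
  compact_EVT_min (ex_intro _ y0 Py0) (compact_contributors bx) cp.
have {}max1 y : Pi x y -> p y <= p y1 by move=> Py; exact/max1/mem_set.
have {}min2 y : Pi x y -> p y2 <= p y by move=> Py; exact/min2/mem_set.
have cr y y' : Pi x y -> Pi x y' -> p y' <= p y ->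
    0 <= edot (perp (y - x)) (y' - x).
  move=> Py Py' pp; rewrite crE subr_ge0.
  by apply: (half_circle_cross (e := eps)); rewrite ?a0 ?ap.
have cr0 y y' : Pi x y -> Pi x y' -> p y' <= p y ->
    edot (perp (y - x)) (y' - x) = 0 ->
    y = y' \/ [/\ a y = 0, a y' = 0, p y = eps & p y' = - eps].
  move=> Py Py' pp /eqP; rewrite crE subr_eq0 => /eqP h.
  have [/(pinj _ _ Py Py')|] :=
    half_circle_cross0 eps_gt0 (a0 _ Py) (a0 _ Py') (ap _ Py) (ap _ Py') pp (esym h);
    by [left|right].
(* Replacing [y'] by [y2] and [y] by [y1] only widens the angle; the former uses the reflection of
   [p] to [- p]. *)
have dotmin y y' : Pi x y -> Pi x y' -> p y' <= p y ->
    edot (y1 - x) (y2 - x) <= edot (y - x) (y' - x).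
  move=> Py Py' pp; rewrite !dotE.
  apply: (@le_trans _ _ (a y * a y2 + p y * p y2)).
    by apply: (half_circle_dot (e := eps)); rewrite ?a0 ?ap ?max1 ?min2.
  have apN z : Pi x z -> a z ^+ 2 + (- p z) ^+ 2 = eps ^+ 2.
    by move=> Pz; rewrite (sqrrN (p z)) ap.
  have := half_circle_dot (a0 _ P2) (a0 _ Py') (a0 _ Py)
    (apN _ P2) (apN _ Py') (apN _ Py).
  rewrite (mulrNN (p y2)) (mulrNN (p y')) !lerN2 => /(_ pp (min2 _ Py')).
  by rewrite ![_ * a y]mulrC ![_ * p y]mulrC; apply.
exists y1, y2; split; last first.
  move=> y y' Py Py'; have [pp|/ltW pp] := leP (p y') (p y); first exact: dotmin.
  by rewrite [leRHS]edotC; apply: dotmin.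
have c0 : 0 <= edot (perp (y1 - x)) (y2 - x) by apply: cr => //; exact: min2.
have outle y xi : Pi x y -> outward_directions E eps x xi -> edot (y - x) xi <= 0.
  by move=> Py; exact: (outward_le0 compact_E eps_gt0 bx Py).
have antip xi : a y1 = 0 -> a y2 = 0 -> p y1 = eps -> p y2 = - eps ->
    outward_directions E eps x xi -> edot (y1 - x) xi = 0 /\ edot (y2 - x) xi = 0.
  move=> a1 a2 p1 p2 oxi; have e21 : y2 - x = - (y1 - x).
    apply/eqP; rewrite -addr_eq0; apply/eqP/edot_eq0.
    by rewrite edot_sqrD !dotE a1 a2 p1 p2; ring.
  have := outle _ _ P1 oxi; have := outle _ _ P2 oxi; rewrite e21 edotNl => h1 h2.
  have h : edot (y1 - x) xi = 0 by lra.
  by rewrite h oppr0.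
apply/seteqP; split=> [y [Py [xi oxi yxi]]|].
  have cy1 : 0 <= edot (perp (y1 - x)) (y - x) by apply: cr => //; exact: max1.
  have cy2 : 0 <= edot (perp (y - x)) (y2 - x) by apply: cr => //; exact: min2.
  have [h|h1] := eqVneq (edot (perp (y1 - x)) (y - x)) 0.
    have [->|[_ ay p1 py]] := cr0 _ _ P1 Py (max1 _ Py) h; first by left.
    right; apply: pinj => //; apply/le_anti; rewrite min2 // andbT py.
    have := ap _ P2; have := sqr_ge0 (a y2) => h2 h3.
    have : `|p y2| <= `|eps|.
      by rewrite -ler_sqr ?nnegrE // !real_normK ?num_real //; lra.
    by rewrite (gtr0_norm eps_gt0) ler_norml => /andP[].
  have [h|h2] := eqVneq (edot (perp (y - x)) (y2 - x)) 0.
    have [->|[ay _ py p2]] := cr0 _ _ Py P2 (min2 _ Py) h; first by right.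
    left; apply: pinj => //; apply/le_anti; rewrite max1 //= py.
    have := ap _ P1; have := sqr_ge0 (a y1) => h2 h3.
    have : `|p y1| <= `|eps|.
      by rewrite -ler_sqr ?nnegrE // !real_normK ?num_real //; lra.
    by rewrite (gtr0_norm eps_gt0) ler_norml => /andP[].
  exfalso.
  have orth u v : edot u xi = 0 -> edot v xi = 0 -> edot (perp u) v = 0.
    move=> hu hv; rewrite -[LHS]mulr1 -(expr1n _ 2) -(proj1 oxi) enorm_sqr.
    by rewrite perp_frame hu hv; ring.
  (* A multiple of [y - x] is a combination of both end vectors with positive coefficients. Paired
     with [xi] it vanishes while both terms are nonpositive, so [y1 - x] is orthogonal to [xi] too,
     hence parallel to [y - x]. *)
  have cram := congr1 (fun v => edot v xi) (perp_cramer (y1 - x) (y2 - x) (y - x)).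
  rewrite /= edotDl !edotZl yxi mulr0 in cram.
  have g1 := outle _ _ P1 oxi; have g2 := outle _ _ P2 oxi.
  have m1 := mulr_ge0_le0 cy2 g1; have m2 := mulr_ge0_le0 cy1 g2.
  have /eqP : edot (perp (y - x)) (y2 - x) * edot (y1 - x) xi = 0 by lra.
  rewrite mulf_eq0 (negbTE h2) /= => /eqP y1xi.
  by rewrite orth ?eqxx in h1.
(* Either the ends are opposite, and every outward direction is orthogonal to both, or all
   contributors lie in an open half plane, and the tangents at the two ends are outward. *)
suff : [/\ a y1 = 0, a y2 = 0, p y1 = eps & p y2 = - eps] \/
    exists eta, forall y, Pi x y -> edot (y - x) eta < 0.
  case=> [[a1 a2 p1 p2]|[eta strict]].
    by have [h1 h2] := antip _ a1 a2 p1 p2 out0; move=> y [->|->]; split=> //;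
      exists xi0.
  have nperp y : Pi x y -> enorm (eps^-1 *: perp (y - x)) = 1.
    move=> /(contributorsP compact_E eps_gt0 _ bx)[_ yx].
    rewrite enormZ gtr0_norm ?invr_gt0 // /enorm edot_perp -/(enorm _) yx.
    by rewrite mulVf // gt_eqF.
  move=> y [->|->]; split=> //.
    exists (- (eps^-1 *: perp (y1 - x))); last first.
      by rewrite edotNr edotZr perp_orth mulr0 oppr0.
    apply: outward_of_strict strict => //; first by rewrite enormN nperp.
    move=> z Pz; rewrite edotNr edotZr oppr_le0 mulr_ge0 ?invr_ge0 ?(ltW eps_gt0) //.
    by rewrite edotC cr ?max1.
  exists (eps^-1 *: perp (y2 - x)); last by rewrite edotZr perp_orth mulr0.
  apply: outward_of_strict strict => //; first by rewrite nperp.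
  move=> z Pz; rewrite edotZr mulr_ge0_le0 ?invr_ge0 ?(ltW eps_gt0) //.
  by rewrite edotC perpC oppr_le0 cr ?min2.
have [c00|c1] := eqVneq (edot (perp (y1 - x)) (y2 - x)) 0.
  have [y12|] := cr0 _ _ P1 P2 (min2 _ P1) c00; last by left.
  right; exists (- (y1 - x)) => // y Py.
  have -> : y = y1 by apply: pinj => //; apply/le_anti; rewrite max1 //= y12 min2.
  rewrite edotNr oppr_lt0 dotE -!expr2 ap // exprn_gt0 //.
(* Minus the bisector of the end vectors. By Cramer's rule the inner product of [y - x] with the
   bisector is a positive multiple of the sum of two nonnegative determinants, not both zero. *)
right; exists (- (y1 - x + (y2 - x))) => // y Py; rewrite edotNr oppr_lt0.
have c2 : 0 < edot (perp (y1 - x)) (y2 - x) by rewrite lt_def c1.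
set m := edot (y1 - x) (y2 - x).
have n1 : edot (y1 - x) (y1 - x) = eps ^+ 2 by rewrite dotE -!expr2 ap.
have n2 : edot (y2 - x) (y2 - x) = eps ^+ 2 by rewrite dotE -!expr2 ap.
have m0 : 0 < eps ^+ 2 + m.
  have := edot_ge0 (y1 - x + (y2 - x)); rewrite le_eqVlt => /orP[/eqP h|].
    have /(congr1 (fun v => edot (perp (y1 - x)) v)) := edot_eq0 (esym h).
    rewrite (edotDr (y1 - x)) edotC perp_orth (edotC _ 0) edot0l => h0.
    by move: c1; rewrite -h0 add0r eqxx.
  rewrite edot_sqrD n1 n2 -/m; lra.
have cram := congr1 (fun v => edot v (y1 - x + (y2 - x)))
  (perp_cramer (y1 - x) (y2 - x) (y - x)).
rewrite /= edotDl !edotZl !(edotDr (y1 - x) (y2 - x)) n1 n2 (edotC (y2 - x) (y1 - x)) -/m in cram.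
have cy1 : 0 <= edot (perp (y1 - x)) (y - x) by apply: cr => //; exact: max1.
have cy2 : 0 <= edot (perp (y - x)) (y2 - x) by apply: cr => //; exact: min2.
rewrite -(pmulr_rgt0 _ c2) (edotDr (y1 - x) (y2 - x)) cram.
have -> : forall b d, b * (eps ^+ 2 + m) + d * (m + eps ^+ 2) =
  (b + d) * (eps ^+ 2 + m) by move=> b d; ring.
rewrite pmulr_lgt0 // lt_def addr_ge0 // andbT.
apply/eqP => /eqP; rewrite paddr_eq0 // => /andP[/eqP b0 /eqP d0].
have := perp_cramer (y1 - x) (y2 - x) (y - x); rewrite b0 d0 !scale0r addr0.
move=> /eqP; rewrite scaler_eq0 (negbTE c1) /= => /eqP vx0.
have := ap _ Py; rewrite /a /p vx0 !edot0l oppr0 expr0n addr0 => /esym/eqP.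
by rewrite expf_eq0 /= gt_eqF.
Qed.
End ExtremalContributors.

(** * Chains and opposite contributors *)

Section Chains.
Variables (R : realType) (E : set 'rV[R]_2) (eps : R).
Hypotheses (compact_E : compact E) (eps_gt0 : 0 < eps).
Implicit Types (u v w x y z p xi : 'rV[R]_2) (r s : R).
Local Notation F := (fattening E eps).
Local Notation Pi := (contributors E eps).

Definition opposed x :=
  boundary F x /\ exists y, [/\ E y, enorm (y - x) = eps & E (x - (y - x))].

(** Exactly opposite contributors have inner product [- eps ^+ 2], and [r] bounds the defect. Any
    pair of contributors may serve, not only the extremal one. *)
Definition nearly_opposed r z := boundary F z /\
  exists y y', [/\ Pi z y, Pi z y' & edot (y - z) (y' - z) <= - eps ^+ 2 + r].

Lemma nearly_opposed_neq r z : r <= eps ^+ 2 -> nearly_opposed r z ->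
  exists y y', [/\ Pi z y, Pi z y' & y <> y'].
Proof.
move=> re [bz [y [y' [Py Py' h]]]]; exists y, y'; split=> // yy.
move: h; rewrite -yy -enorm_sqr.
have [_ ->] := (contributorsP compact_E eps_gt0 _ bz).1 Py.
have := exprn_gt0 2 eps_gt0; lra.
Qed.

Lemma opposed_nearly r z : 0 <= r -> opposed z -> nearly_opposed r z.
Proof.
move=> r0 [bz [y [Ey yz Ey']]]; split=> //; exists y, (z - (y - z)).
have e : z - (y - z) - z = - (y - z) by rewrite addrAC subrr add0r.
split.
- by apply/(contributorsP compact_E eps_gt0 _ bz).
- by apply/(contributorsP compact_E eps_gt0 _ bz); rewrite e enormN.
- by rewrite e edotNr -enorm_sqr yz; lra.
Qed.

(** Nearly opposed points of small defect have two distinct contributors, so near [x] there are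
    always boundary points without a unique one. *)
Lemma singularities_limit x :
  (forall r, 0 < r -> exists z, nearly_opposed r z /\ enorm (z - x) < r) ->
  singularities E eps x.
Proof.
move=> h; split.
  by apply: boundary_fattening_closed => r /h[z [[bz _] zx]]; exists z.
move=> [_ [r r0 rU]].
have e0 : 0 < Num.min r (eps ^+ 2) by rewrite lt_min r0 exprn_gt0.
have [z [nz]] := h _ e0; rewrite lt_min => /andP[zr _].
have [|y [y' [Py Py' yy]]] := nearly_opposed_neq _ nz; first by rewrite ge_min lexx orbT.
have [_ [y0 Pz]] := rU z (conj (proj1 nz) zr).
by apply: yy; move: Py Py'; rewrite Pz => -> ->.
Qed.

Lemma nearly_opposed_singular z : nearly_opposed (eps ^+ 2) z ->
  singularities E eps z.
Proof.
move=> nz; split; first by case: nz.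
move=> [_ [r r0 rU]].
have [y [y' [Py Py' yy]]] := nearly_opposed_neq (lexx _) nz.
have [|_ [y0 Pz]] := rU z.
  by split; [case: nz|rewrite /eball /= subrr enorm0].
by apply: yy; move: Py Py'; rewrite Pz => -> ->.
Qed.

(** This replaces extremal contributors by arbitrary pairs. The extremal pair has the least inner
    product of all pairs, and the Cauchy-Schwarz inequality keeps it above [- eps ^+ 2]. *)
Lemma chain_towardsP x (A : set 'rV[R]_2) : chain_towards E eps x A <->
  forall r, 0 < r -> exists z, [/\ A z, nearly_opposed r z & enorm (z - x) < r].
Proof.
split=> [[u [uAS ux [y1 [y2 [exty cvgy]]]]] r r0|h].
  move/cvg_enormP: ux => /(_ r r0) ux.
  have re0 : 0 < r / eps ^+ 2 by rewrite divr_gt0 ?exprn_gt0.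
  move/cvgrPdist_lt: cvgy => /(_ _ re0) cy.
  have [k [uk yk]] := filter_ex (filterI ux cy).
  have [Auk [buk _]] := uAS k.
  have [P1 _] : extremal_contributors E eps (u k) (y1 k) by rewrite exty; left.
  have [P2 _] : extremal_contributors E eps (u k) (y2 k) by rewrite exty; right.
  exists (u k); split=> //; split=> //; exists (y1 k), (y2 k); split=> //.
  move: yk; rewrite edotZl edotZr ltr_norml => /andP[yk _].
  set d := edot _ _ in yk *.
  have e2 : 0 < eps ^+ 2 by rewrite exprn_gt0.
  have ed : eps^-1 * (eps^-1 * d) = d / eps ^+ 2.
    by rewrite mulrA -invfM mulrC expr2.
  rewrite ed in yk.
  have : d / eps ^+ 2 < - 1 + r / eps ^+ 2 by lra.
  rewrite ltr_pdivrMr // mulrDl divfK ?gt_eqF // mulN1r; exact: ltW.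
have e2 : 0 < eps ^+ 2 by rewrite exprn_gt0.
(* The first bound forces convergence, to [x] and of the inner products; the second makes each [u k]
   a singularity. *)
pose t k : R := Num.min k.+1%:R^-1 (eps ^+ 2).
have t0 k : 0 < t k by rewrite lt_min invr_gt0 ltr0Sn e2.
have t1 k : t k <= k.+1%:R^-1 by rewrite ge_min lexx.
have t2 k : t k <= eps ^+ 2 by rewrite ge_min lexx orbT.
have /choice[u hu] k := h (t k) (t0 k).
have bu k : boundary F (u k) by have [_ []] := hu k.
have /choice[y hy] k : exists yy : 'rV[R]_2 * 'rV[R]_2,
    extremal_contributors E eps (u k) = [set yy.1; yy.2] /\
    forall y' y'', Pi (u k) y' -> Pi (u k) y'' ->
      edot (yy.1 - u k) (yy.2 - u k) <= edot (y' - u k) (y'' - u k).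
  have [y1 [y2 H]] := extremal_contributorsP compact_E eps_gt0 (bu k).
  by exists (y1, y2).
exists u; split.
- move=> k; have [Auk nuk _] := hu k; split=> //.
  apply: nearly_opposed_singular; case: nuk => b [y1 [y2 [P1 P2 h12]]].
  by split=> //; exists y1, y2; split=> //; have := t2 k; lra.
- apply/cvg_enormP => r r0; have := invS_lt r0; apply: filterS => k kr.
  by have [_ _ /lt_le_trans] := hu k; apply; apply: le_trans (ltW kr).
exists (fun k => (y k).1), (fun k => (y k).2); split; first by move=> k; have [] := hy k.
apply/cvgrPdist_lt => r r0.
have re0 : 0 < r * eps ^+ 2 by rewrite mulr_gt0.
have := invS_lt re0; apply: filterS => k kr.
have [exty miny] := hy k; have [_ [b [y1 [y2 [P1 P2 h12]]]] _] := hu k.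
have [Q1 _] : extremal_contributors E eps (u k) (y k).1 by rewrite exty; left.
have [Q2 _] : extremal_contributors E eps (u k) (y k).2 by rewrite exty; right.
have := miny _ _ P1 P2; rewrite edotZl edotZr.
have := edot_le_enorm (- ((y k).1 - u k)) ((y k).2 - u k); rewrite enormN edotNl.
have [_ ->] := (contributorsP compact_E eps_gt0 _ b).1 Q1.
have [_ ->] := (contributorsP compact_E eps_gt0 _ b).1 Q2.
set d := edot (_.1 - _) _; move=> hd1 hd2.
have ed : eps^-1 * (eps^-1 * d) = d / eps ^+ 2.
  by rewrite mulrA -invfM mulrC expr2.
have h1 : - 1 <= d / eps ^+ 2 by rewrite ler_pdivlMr // mulN1r expr2; lra.
have h2 : d / eps ^+ 2 < - 1 + r.
  rewrite ltr_pdivrMr // mulrDl mulN1r; have := le_lt_trans (t1 k) kr; lra.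
by rewrite ed ltr_norml; apply/andP; split; lra.
Qed.

Lemma opposed_limit x :
  (forall r, 0 < r -> exists z, nearly_opposed r z /\ enorm (z - x) < r) ->
  opposed x.
Proof.
move=> h; have bx : boundary F x.
  by apply: boundary_fattening_closed => r /h[z [[bz _] zx]]; exists z.
split=> //; apply: contrapT => nopp.
(* On pairs from [E], [f] is at least [eps], with equality only for opposite contributors of [x].
   Without such a pair compactness gives a gap, which nearly opposed points near [x] violate. *)
pose f (yy : 'rV[R]_2 * 'rV[R]_2) := enorm (yy.1 - x + (yy.2 - x)) + enorm (yy.1 - x).
have cf : continuous f.
  move=> yy; apply: cvgD.
    apply: (continuous_enorm (f := fun yy : 'rV[R]_2 * 'rV[R]_2 => yy.1 - x + (yy.2 - x))).
    apply: continuousD; apply: continuousB; try exact: cst_continuous.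
      exact: cvg_fst.
    exact: cvg_snd.
  apply: (continuous_enorm (f := fun yy : 'rV[R]_2 * 'rV[R]_2 => yy.1 - x)).
  by apply: continuousB; [exact: cvg_fst|exact: cst_continuous].
have [[y y'] [/= Ey Ey']|r r0 rE] :=
    compact_gt_bound (a := eps) (compact_setX compact_E compact_E) cf.
  rewrite /f /=; have := boundary_dist compact_E eps_gt0 bx Ey.
  have := enorm_ge0 (y - x + (y' - x)).
  rewrite le_eqVlt => /orP[/eqP/esym h0|]; last by lra.
  rewrite le_eqVlt => /orP[/eqP/esym h1|]; last by lra.
  exfalso; apply: nopp; exists y; split=> //.
  have v0 : y - x + (y' - x) = 0 by apply: edot_eq0; rewrite -enorm_sqr h0 expr0n.
  by rewrite (addr0_eq v0) addrC subrK.
(* The bound [r ^+ 2 / 32] keeps the sum of the contributor vectors at [z] within [r / 4]; the bound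
   [r / 8] absorbs three shifts from [z] to [x]. *)
pose t := Num.min (r / 8) (r ^+ 2 / 32).
have t0 : 0 < t by rewrite lt_min !divr_gt0 ?exprn_gt0.
have t1 : t <= r / 8 by rewrite ge_min lexx.
have t2 : t <= r ^+ 2 / 32 by rewrite ge_min lexx orbT.
have [z [[bz [y [y' [Py Py' h12]]]] zx]] := h t t0.
have [Ey yz] := (contributorsP compact_E eps_gt0 _ bz).1 Py.
have [Ey' y'z] := (contributorsP compact_E eps_gt0 _ bz).1 Py'.
have := rE (y, y') (conj Ey Ey'); rewrite /f /=.
have hy := enorm_triangle y z x; rewrite yz in hy.
have hs : enorm (y - z + (y' - z)) <= r / 4.
  rewrite enorm_le; last by lra.
  rewrite edot_sqrD -!enorm_sqr yz y'z.
  rewrite exprMn; lra.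
have e : y - x + (y' - x) = (y - z + (y' - z)) + ((z - x) + (z - x)).
  by rewrite [RHS]addrACA !subrKA.
have := enormD (y - z + (y' - z)) ((z - x) + (z - x)); rewrite -e.
have := enormD (z - x) (z - x); lra.
Qed.

End Chains.

(** * Orthonormal frames and circular arcs *)

Section Frames.
Variable R : realType.
Implicit Types (u v w x y z p xi n : 'rV[R]_2) (a b r s t : R).

(** No orientation is fixed, so that [xi] and [n] can be reversed independently. *)
Definition orthonormal xi n :=
  [/\ edot xi xi = 1, edot n n = 1 & edot xi n = 0].

Lemma orthonormal_perp xi : enorm xi = 1 -> orthonormal xi (perp xi).
Proof.
by move=> xi1; split; rewrite ?edot_perp ?perp_orth // -enorm_sqr xi1 expr1n.
Qed.

Lemma orthonormalNl xi n : orthonormal xi n -> orthonormal (- xi) n.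
Proof. by move=> [h1 h2 h3]; split; rewrite ?edotNl ?edotNr ?opprK // h3 oppr0. Qed.

Lemma orthonormalNr xi n : orthonormal xi n -> orthonormal xi (- n).
Proof. by move=> [h1 h2 h3]; split; rewrite ?edotNl ?edotNr ?opprK // h3 oppr0. Qed.

Lemma orthonormalC xi n : orthonormal xi n -> orthonormal n xi.
Proof. by move=> [h1 h2 h3]; split; rewrite // edotC. Qed.

Lemma parseval xi n v w : orthonormal xi n ->
  edot v w = edot v xi * edot w xi + edot v n * edot w n.
Proof.
move=> [xi1 n1 xin].
have fr v' w' : edot v' w' =
    edot v' xi * edot w' xi + edot v' (perp xi) * edot w' (perp xi).
  by rewrite -edot_frame xi1 mulr1.
have n2 : edot n (perp xi) ^+ 2 = 1.
  by have := fr n n; rewrite n1 (edotC n xi) xin mul0r add0r -expr2.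
have dn u : edot u n = edot u (perp xi) * edot n (perp xi).
  by rewrite fr (edotC n xi) xin mulr0 add0r.
by rewrite fr !dn mulrACA -expr2 n2 mulr1.
Qed.

Lemma orthonormal_decomp xi n v : orthonormal xi n ->
  v = edot v xi *: xi + edot v n *: n.
Proof.
move=> on; have [xi1 n1 xin] := on.
apply/eqP; rewrite -subr_eq0; apply/eqP/edot_eq0.
rewrite (parseval _ _ on) !edot_linear xi1 n1 (edotC n xi) xin; ring.
Qed.

Lemma closer_on_circle x y p p' : enorm (p - x) = enorm (p' - x) ->
  (enorm (y - p') <= enorm (y - p)) = (edot (y - x) (p - x) <= edot (y - x) (p' - x)).
Proof.
move=> pp; rewrite -ler_sqr ?nnegrE ?enorm_ge0 // !enorm_sqr.
have e q : y - q = (y - x) - (q - x) by rewrite opprB addrA subrK.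
rewrite (e p) (e p') !(edot_sqrB (y - x)) -!enorm_sqr pp !enorm_sqr.
by rewrite lerD2r lerD2l lerN2 !mulr2n; apply/idP/idP; lra.
Qed.

(** In the sector [|v| <= u] ordinates vary at least as fast as abscissas: compare the two
    differences of squares, using that [v + v'] is at most [u + u'] in absolute value. *)
Lemma arc_lipschitz (u v u' v' : R) : u ^+ 2 + v ^+ 2 = u' ^+ 2 + v' ^+ 2 ->
  `|v| <= u -> `|v'| <= u' -> `|u - u'| <= `|v - v'|.
Proof.
move=> uv vu vu'.
have [u0 u'0] : 0 <= u /\ 0 <= u'.
  by split; [apply: le_trans vu|apply: le_trans vu'].
have [s0|s0] := eqVneq (u + u') 0.
  have -> : u - u' = 0 by lra.
  by rewrite normr0 normr_ge0.
have s1 : 0 < u + u' by rewrite lt_def s0 addr_ge0.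
rewrite -(ler_pM2r s1) -{1}(gtr0_norm s1) -normrM.
have -> : (u - u') * (u + u') = (v' - v) * (v' + v) by lra.
rewrite normrM distrC ler_wpM2l //.
by apply: (le_trans (ler_normD _ _)); lra.
Qed.

Lemma arc_dot_mono (a b u v u' v' : R) : u ^+ 2 + v ^+ 2 = u' ^+ 2 + v' ^+ 2 ->
  `|v| <= u -> `|v'| <= u' -> v <= v' -> `|a| <= b ->
  a * u + b * v <= a * u' + b * v'.
Proof.
move=> uv vu vu' vv ab; have := arc_lipschitz uv vu vu'.
rewrite (distrC v) (ger0_norm (_ : 0 <= v' - v)) ?subr_ge0 // => lip.
have : a * (u - u') <= b * (v' - v); last by lra.
apply: le_trans (ler_norm _) _; rewrite normrM ler_pM //.
Qed.

Lemma arc_dot_smono (a b u v u' v' : R) : u ^+ 2 + v ^+ 2 = u' ^+ 2 + v' ^+ 2 ->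
  `|v| <= u -> `|v'| <= u' -> v < v' -> `|a| < b ->
  a * u + b * v < a * u' + b * v'.
Proof.
move=> uv vu vu' vv ab.
have := arc_dot_mono uv vu vu' (ltW vv) (lexx `|a|).
have : 0 < (b - `|a|) * (v' - v) by rewrite mulr_gt0 // subr_gt0.
lra.
Qed.

(* Point of abscissa [sqrt (r^2 - t^2)] and ordinate [t] in the frame at [x];
   meaningful for [t^2 <= r^2]. *)
Definition arc_point x xi n r t :=
  x + (Num.sqrt (r ^+ 2 - t ^+ 2) *: xi + t *: n).

Lemma arc_pointV x xi n r t : orthonormal xi n ->
  edot (arc_point x xi n r t - x) n = t.
Proof.
move=> [_ n1 xin]; rewrite /arc_point [x + _]addrC addrK.
by rewrite edotDl !edotZl n1 xin; ring.
Qed.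

Lemma arc_pointU x xi n r t : orthonormal xi n ->
  edot (arc_point x xi n r t - x) xi = Num.sqrt (r ^+ 2 - t ^+ 2).
Proof.
move=> [xi1 _ xin]; rewrite /arc_point [x + _]addrC addrK.
by rewrite edotDl !edotZl xi1 (edotC n) xin; ring.
Qed.

Lemma arc_point_enorm x xi n r t : orthonormal xi n -> 0 <= r -> t ^+ 2 <= r ^+ 2 ->
  enorm (arc_point x xi n r t - x) = r.
Proof.
move=> on r0 vr; apply/enorm_eq => //.
rewrite (parseval _ _ on) arc_pointU // arc_pointV // -!expr2 sqr_sqrtr ?subr_ge0 //.
by rewrite subrK.
Qed.

Lemma enorm_frame x xi n p : orthonormal xi n ->
  edot (p - x) xi ^+ 2 + edot (p - x) n ^+ 2 = enorm (p - x) ^+ 2.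
Proof. by move=> on; rewrite enorm_sqr (parseval (p - x) (p - x) on) !expr2. Qed.

Lemma arc_pointE x xi n p : orthonormal xi n -> 0 <= edot (p - x) xi ->
  arc_point x xi n (enorm (p - x)) (edot (p - x) n) = p.
Proof.
move=> on U0; rewrite /arc_point -(enorm_frame x p on) addrK sqrtr_sqr ger0_norm //.
by rewrite -(orthonormal_decomp _ on) addrC subrK.
Qed.

Lemma continuous_arc_point x xi n r : continuous (arc_point x xi n r).
Proof.
move=> t; apply: cvgD; first exact: cvg_cst.
apply: cvgD; last by apply: cvgZr_tmp; exact: cvg_id.
apply: cvgZr_tmp.
apply: (@continuous_comp _ _ _ (fun t => r ^+ 2 - t ^+ 2) Num.sqrt).
  by apply: cvgB; [exact: cvg_cst|exact: exprn_continuous].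
exact: sqrt_continuous.
Qed.

End Frames.

(** * The fattening near a point with opposite contributors *)

Section LocalPicture.
Variables (R : realType) (E : set 'rV[R]_2) (eps : R).
Hypotheses (compact_E : compact E) (eps_gt0 : 0 < eps).
Implicit Types (u v w x y z p xi n : 'rV[R]_2) (d k r s : R).
Local Notation F := (fattening E eps).
Local Notation Pi := (contributors E eps).

(** The points [p] may lie on the boundary of the fattening, so boundary points near [x] qualify as
    well as complement points. *)
Definition approached x xi := forall r, 0 < r -> exists p,
  [/\ 0 < edot (p - x) xi, enorm (p - x) < r &
      forall y, E y -> eps <= enorm (y - p)].

Definition antipodal_pair x n := [/\ forall y, E y -> eps <= enorm (y - x),
  E (x + eps *: n) & E (x - eps *: n)].

Definition in_cone x xi n k p :=
  0 < edot (p - x) xi /\ `|edot (p - x) n| <= k * edot (p - x) xi.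

(* At scale [d], the points of the narrow cone around [xi] only see the parts
   of [E] near the two opposite contributors [x + eps *: n], [x - eps *: n]. *)
Definition local_frame x xi n k d :=
  [/\ orthonormal xi n, antipodal_pair x n, 0 < k <= 1 / 4, 0 < d <= k * eps &
   forall p y, E y -> enorm (p - x) < d -> in_cone x xi n k p ->
     enorm (y - p) <= eps -> `|edot (y - x) xi| <= 2 * k * eps].

Lemma local_frameN x xi n k d :
  local_frame x xi n k d -> local_frame x xi (- n) k d.
Proof.
move=> [on [xE E1 E2] k0 d0 thin]; split=> //; first exact: orthonormalNr.
  by split; rewrite ?scalerN ?opprK.
move=> p y Ey pd [U0 Vk]; apply: thin => //; split=> //.
by move: Vk; rewrite edotNr normrN.
Qed.

(** [p] lies outside two open discs of radius [eps] that touch at [x]. In the frame this reads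
    [2 * eps * |V| <= U ^+ 2 + V ^+ 2], where [V ^+ 2 <= eps * |V|]. *)
Lemma cusp_le x xi n p : orthonormal xi n -> antipodal_pair x n ->
  (forall y, E y -> eps <= enorm (y - p)) -> enorm (p - x) <= eps ->
  eps * `|edot (p - x) n| <= edot (p - x) xi ^+ 2.
Proof.
move=> on [_ E1 E2] pE pe; have [_ n1 _] := on.
have := enorm_frame x p on.
have := pE _ E2; have := pE _ E1; rewrite !enorm_ge ?(ltW eps_gt0) //.
have -> : x + eps *: n - p = eps *: n - (p - x) by rewrite opprB addrA addrAC addrC addrA.
have -> : x - eps *: n - p = - (eps *: n + (p - x)).
  by rewrite opprD opprB addrA addrAC addrC addrA.
move: pe; move: (p - x) => v pe.
rewrite edotNl edotNr opprK edot_sqrB edot_sqrD !edotZl !edotZr n1.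
rewrite (edotC n v) -(enorm_sqr v).
set V := edot v n; set U := edot v xi; set N := enorm v => h1 h2 h3.
have N2 : N ^+ 2 <= eps ^+ 2 by rewrite ler_sqr ?nnegrE ?enorm_ge0 // ltW.
have V2 : V ^+ 2 <= eps * `|V|.
  rewrite -real_normK ?num_real // expr2 ler_wpM2r //.
  by rewrite -ler_sqr ?nnegrE ?(ltW eps_gt0) // real_normK ?num_real //; have := sqr_ge0 U; lra.
by move: V2; have [V0|V0] := ger0P V; lra.
Qed.

(** For [a > 0], a cusp point [p] at distance at least [eps] from [y] satisfies
    [a * U <= 2 * U ^+ 2], because the terms in [V] are of second order in [U]; this fails once [p]
    is near [x]. *)
Lemma contributor_behind x xi n y : orthonormal xi n -> antipodal_pair x n ->
  approached x xi -> E y -> enorm (y - x) = eps -> edot (y - x) xi <= 0.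
Proof.
move=> on anti app Ey yx; rewrite leNgt; apply/negP; set a := edot _ _ => a0.
pose m := Num.min eps (a / 2).
have [|p [U0 pm pE]] := app m; first by rewrite lt_min eps_gt0 divr_gt0.
have [pe pa] : enorm (p - x) < eps /\ enorm (p - x) < a / 2.
  by move: pm; rewrite lt_min => /andP[].
have cusp := cusp_le on anti pE (ltW pe).
have := enorm_frame x p on; have := pE _ Ey; rewrite enorm_ge ?(ltW eps_gt0) //.
have -> : y - p = (y - x) - (p - x) by rewrite opprB addrA subrK.
rewrite edot_sqrB -!enorm_sqr yx (parseval (y - x) (p - x) on) -/a.
move: U0 pm pa pe cusp.
set U := edot (p - x) xi; set V := edot (p - x) n; set b := edot (y - x) n.
set N := enorm _ => U0 pm pa pe cusp h1 h2.
have be : `|b| <= eps.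
  have := enorm_frame x y on; rewrite yx -/a -/b => h3.
  rewrite -ler_sqr ?nnegrE ?(ltW eps_gt0) // real_normK ?num_real //.
  by have := sqr_ge0 a; lra.
have bV : - (b * V) <= U ^+ 2.
  apply: le_trans (ler_norm _) _; rewrite normrN normrM.
  by apply: le_trans cusp; rewrite ler_wpM2r.
have UN : U <= N.
  rewrite -ler_sqr ?nnegrE ?enorm_ge0 ?(ltW U0) //; have := sqr_ge0 V; lra.
have V2 : V ^+ 2 <= U ^+ 2.
  rewrite -real_normK ?num_real // -[leRHS]real_normK ?num_real //.
  rewrite ler_sqr ?nnegrE //; rewrite -(ler_pM2l eps_gt0); apply: le_trans cusp _.
  by rewrite (gtr0_norm U0) expr2 ler_wpM2r ?(ltW U0) //; lra.
have : a * U <= 2 * U * U by rewrite -mulrA -expr2; lra.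
rewrite ler_pM2r //; lra.
Qed.

(** The upper bound on the coordinate along [xi] comes from compactness, as no contributor lies
    ahead of [x]. The lower bound holds because [y] is no farther from [p] than from [x]. *)
Lemma exists_local_frame x xi n k : orthonormal xi n -> antipodal_pair x n ->
  approached x xi -> 0 < k <= 1 / 4 -> exists d, local_frame x xi n k d.
Proof.
move=> on anti app /andP[k0 k1]; have [xE _ _] := anti.
have ke : 0 < k * eps by rewrite mulr_gt0.
have cE' : compact (E `&` [set y | k * eps <= edot (y - x) xi]).
  apply: compact_closedI => //.
  apply: (preimage_closed (f := fun y => edot (y - x) xi)) (@closed_ge _ _).
  by move=> y _; exact: continuous_edotB.
have [y [Ey /= yk]|r r0 rE] :=
    compact_gt_bound (a := eps) cE' (@continuous_enormB _ x).
  rewrite lt_def xE // andbT; apply/eqP => yx.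
  by have := contributor_behind on anti app Ey yx; lra.
pose d := Num.min (r / 2) (k * eps).
have d0 : 0 < d by rewrite lt_min ke divr_gt0.
have dr : d <= r / 2 by rewrite ge_min lexx.
have dk : d <= k * eps by rewrite ge_min lexx orbT.
exists d; split=> //; [by rewrite k0|by rewrite d0|].
move=> p y Ey pd [U0 Vk] yp; rewrite ler_norml; apply/andP; split; last first.
  have [yk|] := leP (k * eps) (edot (y - x) xi); last by lra.
  by have := rE y (conj Ey yk); have := enorm_triangle y p x; lra.
have := xE y Ey; rewrite enorm_ge ?(ltW eps_gt0) //.
have : edot (y - p) (y - p) <= eps ^+ 2 by rewrite -enorm_le // ltW.
have -> : y - p = (y - x) - (p - x) by rewrite opprB addrA subrK.
rewrite edot_sqrB (parseval (y - x) (p - x) on) => h1 h2.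
have := edot_ge0 (p - x) => h3.
have bd : `|edot (y - x) n| <= 2 * eps.
  have := enorm_triangle y p x => h4.
  have h5 : enorm (y - x) <= 2 * eps.
    have : k * eps <= 1 / 4 * eps by rewrite ler_pM2r.
    by lra.
  apply: le_trans h5; rewrite -ler_sqr ?nnegrE ?enorm_ge0 // real_normK ?num_real //.
  by rewrite -(enorm_frame x y on) lerDr sqr_ge0.
have h6 : `|edot (y - x) n * edot (p - x) n| <= 2 * eps * (k * edot (p - x) xi).
  by rewrite normrM ler_pM.
have : - (2 * k * eps) * edot (p - x) xi <= edot (y - x) xi * edot (p - x) xi.
  by move: h6; rewrite ler_norml => /andP[_]; lra.
by rewrite ler_pM2r.
Qed.

End LocalPicture.

(** * Circular arcs in the cone, seen from above and from below *)

Section Arcs.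
Variables (R : realType) (E : set 'rV[R]_2) (eps : R).
Hypotheses (compact_E : compact E) (eps_gt0 : 0 < eps).
Implicit Types (u v w x y z p xi n : 'rV[R]_2) (d k r s : R).
Local Notation F := (fattening E eps).
Local Notation Pi := (contributors E eps).

(** At scale [d <= k * eps] the quadratic cusp is thinner than the linear cone. *)
Lemma far_in_cone x xi n k d p : local_frame E eps x xi n k d ->
  (forall y, E y -> eps <= enorm (y - p)) -> enorm (p - x) < d ->
  0 < edot (p - x) xi -> `|edot (p - x) n| < k * edot (p - x) xi.
Proof.
move=> [on anti /andP[k0 k1] /andP[d0 dk] _] pE pd U0.
have ke : k * eps <= 1 / 4 * eps by rewrite ler_pM2r.
have := cusp_le eps_gt0 on anti pE _; have pe : enorm (p - x) <= eps by lra.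
move=> /(_ pe) cusp.
have Ud : edot (p - x) xi <= enorm (p - x).
  rewrite -ler_sqr ?nnegrE ?enorm_ge0 ?(ltW U0) // -(enorm_frame x p on).
  by rewrite lerDl sqr_ge0.
rewrite -(ltr_pM2l eps_gt0); apply: le_lt_trans cusp _.
by rewrite expr2 mulrA ltr_pM2r //; lra.
Qed.

Lemma in_cone_far x xi n k d p : local_frame E eps x xi n k d ->
  (forall y, E y -> eps <= enorm (y - p)) -> enorm (p - x) < d ->
  0 < edot (p - x) xi -> in_cone x xi n k p.
Proof. by move=> lf pE pd U0; split=> //; exact/ltW/(far_in_cone lf). Qed.

Lemma in_cone_quarter x xi n k d p : local_frame E eps x xi n k d ->
  in_cone x xi n k p -> `|edot (p - x) n| <= edot (p - x) xi.
Proof.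
move=> [_ _ /andP[k0 k1] _ _] [U0] /le_trans; apply.
by rewrite ler_piMl ?(ltW U0) //; lra.
Qed.

(** [y] is at least [eps] away from [x] with a small component along [xi], so it lies clearly above
    or clearly below [x]. *)
Lemma seen_coords x xi n k d p y : local_frame E eps x xi n k d ->
  E y -> enorm (p - x) < d -> in_cone x xi n k p -> enorm (y - p) <= eps ->
  `|edot (y - x) xi| <= eps / 2 /\ eps / 2 < `|edot (y - x) n|.
Proof.
move=> [on [xE _ _] /andP[k0 k1] _ thin] Ey pd pc yp.
have Uy := thin p y Ey pd pc yp.
have ke : k * eps <= 1 / 4 * eps by rewrite ler_pM2r.
have Uy2 : `|edot (y - x) xi| <= eps / 2 by lra.
split=> //; have := xE y Ey; rewrite -ler_sqr ?nnegrE ?enorm_ge0 ?(ltW eps_gt0) //.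
rewrite -(enorm_frame x y on) => h.
have hU : edot (y - x) xi ^+ 2 <= (eps / 2) ^+ 2.
  by rewrite -real_normK ?num_real // ler_sqr ?nnegrE ?divr_ge0 ?(ltW eps_gt0).
rewrite -ltr_sqr ?nnegrE ?divr_ge0 ?(ltW eps_gt0) // real_normK ?num_real //.
by have := exprn_gt0 2 eps_gt0; rewrite expr_div_n in hU *; lra.
Qed.

Lemma up_closer x xi n k d p p' y : local_frame E eps x xi n k d ->
  enorm (p - x) = enorm (p' - x) -> in_cone x xi n k p -> in_cone x xi n k p' ->
  edot (p - x) n <= edot (p' - x) n -> `|edot (y - x) xi| <= edot (y - x) n ->
  enorm (y - p') <= enorm (y - p).
Proof.
move=> lf pp pc pc' VV yc; have [on _ _ _ _] := lf.
rewrite (closer_on_circle y pp)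
  (parseval (y - x) (p - x) on) (parseval (y - x) (p' - x) on).
by apply: arc_dot_mono; rewrite ?(enorm_frame x _ on) ?pp //; apply: (in_cone_quarter lf).
Qed.

Lemma up_strictly_closer x xi n k d p p' y : local_frame E eps x xi n k d ->
  enorm (p - x) = enorm (p' - x) -> in_cone x xi n k p -> in_cone x xi n k p' ->
  edot (p - x) n < edot (p' - x) n -> `|edot (y - x) xi| < edot (y - x) n ->
  enorm (y - p') < enorm (y - p).
Proof.
move=> lf pp pc pc' VV yc; have [on _ _ _ _] := lf.
rewrite ltNge (closer_on_circle y (esym pp)) -ltNge
  (parseval (y - x) (p - x) on) (parseval (y - x) (p' - x) on).
by apply: arc_dot_smono; rewrite ?(enorm_frame x _ on) ?pp //; apply: (in_cone_quarter lf).
Qed.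

Definition full_arc x xi r :=
  forall p, 0 < edot (p - x) xi -> enorm (p - x) = r -> F p.

(** Moving up the arc brings points closer to any point of [E] seen above. *)
Lemma seen_up_mono x xi n k d p p' y : local_frame E eps x xi n k d ->
  E y -> enorm (p - x) < d -> in_cone x xi n k p -> enorm (y - p) <= eps ->
  0 < edot (y - x) n -> enorm (p - x) = enorm (p' - x) -> in_cone x xi n k p' ->
  edot (p - x) n <= edot (p' - x) n -> F p'.
Proof.
move=> lf Ey pd pc yp Vy pp pc' VV; apply/(fatteningP compact_E eps_gt0).
have [Uy] := seen_coords lf Ey pd pc yp; rewrite (gtr0_norm Vy) => Vy2.
exists y => //; apply: le_trans yp; apply: (up_closer lf) => //; lra.
Qed.

Lemma seen_down_mono x xi n k d p p' y : local_frame E eps x xi n k d ->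
  E y -> enorm (p - x) < d -> in_cone x xi n k p -> enorm (y - p) <= eps ->
  edot (y - x) n < 0 -> enorm (p - x) = enorm (p' - x) -> in_cone x xi n k p' ->
  edot (p' - x) n <= edot (p - x) n -> F p'.
Proof.
move=> lf Ey pd [pc1 pc2] yp Vy pp [pc1' pc2'] VV.
by apply: (seen_up_mono (local_frameN lf) Ey pd) => //;
  rewrite ?edotNr ?oppr_gt0 ?lerN2 //; split; rewrite ?edotNr ?normrN.
Qed.

Lemma seen_sign x xi n k d p y : local_frame E eps x xi n k d ->
  E y -> enorm (p - x) < d -> in_cone x xi n k p -> enorm (y - p) <= eps ->
  edot (y - x) n < 0 \/ 0 < edot (y - x) n.
Proof.
move=> lf Ey pd pc yp; have [_ h] := seen_coords lf Ey pd pc yp.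
apply/orP; rewrite -neq_lt; apply/eqP => h0; move: h; rewrite h0 normr0.
by apply/negP; rewrite -leNgt divr_ge0 // ltW.
Qed.

Lemma nfattening_in_cone x xi n k d p : local_frame E eps x xi n k d ->
  ~ F p -> enorm (p - x) < d -> 0 < edot (p - x) xi -> in_cone x xi n k p.
Proof.
move=> lf /(nfatteningP compact_E eps_gt0) pE; apply: (in_cone_far lf) => y Ey.
exact/ltW/pE.
Qed.

Lemma arc_cone_between x xi n k d p p1 p2 : local_frame E eps x xi n k d ->
  in_cone x xi n k p1 -> in_cone x xi n k p2 -> 0 < edot (p - x) xi ->
  enorm (p1 - x) = enorm (p - x) -> enorm (p2 - x) = enorm (p - x) ->
  edot (p1 - x) n <= edot (p - x) n -> edot (p - x) n <= edot (p2 - x) n ->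
  in_cone x xi n k p.
Proof.
move=> [on _ /andP[k0 k1] _ _] [U1 c1] [U2 c2] U0 e1 e2 V1 V2; split=> //.
have key q : 0 < edot (q - x) xi -> `|edot (q - x) n| <= k * edot (q - x) xi ->
    enorm (q - x) = enorm (p - x) -> `|edot (p - x) n| <= `|edot (q - x) n| ->
    `|edot (p - x) n| <= k * edot (p - x) xi.
  move=> Uq cq eq le; apply: (le_trans le); apply: (le_trans cq).
  rewrite ler_pM2l // -ler_sqr ?nnegrE ?(ltW U0) ?(ltW Uq) //.
  have : edot (p - x) n ^+ 2 <= edot (q - x) n ^+ 2.
    by rewrite -real_normK ?num_real // -[leRHS]real_normK ?num_real // ler_sqr ?nnegrE.
  have := enorm_frame x q on; rewrite eq -(enorm_frame x p on); lra.
have [V0|V0] := leP 0 (edot (p - x) n).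
  apply: (key p2) => //; rewrite !ger0_norm //; exact: le_trans V2.
apply: (key p1) => //; rewrite !ltr0_norm ?lerN2 //; exact: le_lt_trans V0.
Qed.

(** A fattening point between [p1] and [p2] is seen from above or from below, which would bring [p2]
    or [p1] into the fattening. So the complement meets each arc in an arc. *)
Lemma nfattening_between x xi n k d p p1 p2 : local_frame E eps x xi n k d ->
  ~ F p1 -> ~ F p2 -> 0 < edot (p1 - x) xi -> 0 < edot (p2 - x) xi ->
  0 < edot (p - x) xi -> enorm (p - x) < d ->
  enorm (p1 - x) = enorm (p - x) -> enorm (p2 - x) = enorm (p - x) ->
  edot (p1 - x) n <= edot (p - x) n -> edot (p - x) n <= edot (p2 - x) n ->
  ~ F p.
Proof.
move=> lf F1 F2 U1 U2 U0 pd e1 e2 V1 V2 Fp.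
have c1 : in_cone x xi n k p1 by apply: (nfattening_in_cone lf); rewrite // e1.
have c2 : in_cone x xi n k p2 by apply: (nfattening_in_cone lf); rewrite // e2.
have pc := arc_cone_between lf c1 c2 U0 e1 e2 V1 V2.
have [y Ey yp] := (fatteningP compact_E eps_gt0 p).1 Fp.
have [Vy|Vy] := seen_sign lf Ey pd pc yp.
  by apply: F1; exact: (seen_down_mono lf Ey pd pc yp Vy (esym e1)).
by apply: F2; exact: (seen_up_mono lf Ey pd pc yp Vy (esym e2)).
Qed.

(** Every cone point of the arc is above [z], hence seen from [y], or below [z], hence seen from
    [y']. *)
Lemma two_sided_full x xi n k d z y y' : local_frame E eps x xi n k d ->
  enorm (z - x) < d -> in_cone x xi n k z -> E y -> E y' ->
  enorm (y - z) <= eps -> enorm (y' - z) <= eps ->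
  0 < edot (y - x) n -> edot (y' - x) n < 0 -> full_arc x xi (enorm (z - x)).
Proof.
move=> lf zd zc Ey Ey' yz yz' Vy Vy' p U0 pz; apply: contrapT => Fp.
have pc : in_cone x xi n k p by apply: (nfattening_in_cone lf); rewrite // pz.
have [VV|/ltW VV] := leP (edot (z - x) n) (edot (p - x) n); apply: Fp.
  exact: (seen_up_mono lf Ey zd zc yz Vy (esym pz)).
exact: (seen_down_mono lf Ey' zd zc yz' Vy' (esym pz)).
Qed.

(* If [z] had no contributor below it, then, the arc being full, points of the
   arc slightly below [z] would be seen from above only, and [z], being strictly
   closer to the points of [E] above, would be interior. *)
Lemma lower_contributor x xi n k d z : local_frame E eps x xi n k d ->
  boundary F z -> enorm (z - x) < d -> 0 < edot (z - x) xi ->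
  full_arc x xi (enorm (z - x)) ->
  exists y, [/\ E y, enorm (y - z) <= eps & edot (y - x) n < 0].
Proof.
move=> lf bz zd U0 full; have [on _ /andP[k0 k1] _ _] := lf.
have zE y : E y -> eps <= enorm (y - z) by exact: boundary_dist.
have zV := far_in_cone lf zE zd U0.
have zc : in_cone x xi n k z := conj U0 (ltW zV).
apply: contrapT => none.
have cE' : compact (E `&` [set y | 0 <= edot (x - y) n]).
  apply: compact_closedI => //.
  apply: (preimage_closed (f := fun y => edot (x - y) n)) (@closed_ge _ _).
  move=> y _; apply: (continuous_edot (f := fun y => x - y) (g := fun=> n));
    last exact: cst_continuous.
  by apply: continuousB => //; exact: cst_continuous.
(* Without a lower contributor, all points of [E] that are not above [x] stay [eta] farther than
   [eps] from [z]. *)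
have [y [Ey /= yV]|eta eta0 etaE] :=
    compact_gt_bound (a := eps) cE' (@continuous_enormB _ z).
  rewrite lt_def zE // andbT; apply/eqP => yz.
  have yze : enorm (y - z) <= eps by rewrite yz.
  have := seen_sign lf Ey zd zc yze; rewrite -opprB edotNl in yV.
  by case=> [h|]; [apply: none; exists y|lra].
pose gam := arc_point x xi n (enorm (z - x)).
have gz : gam (edot (z - x) n) = z by rewrite /gam arc_pointE // ltW.
have cg : continuous gam := @continuous_arc_point _ x xi n _.
have cU : continuous (fun t => k * edot (gam t - x) xi - `|edot (gam t - x) n|).
  move=> t; have c1 u : {for t, continuous (fun s => edot (gam s - x) u)}.
    apply: (continuous_edot (f := fun s => gam s - x) (g := fun=> u));
      last exact: cst_continuous.
    by apply: continuousB; [exact: cg|exact: cst_continuous].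
  apply: cvgB; first by apply: cvgM; [exact: cvg_cst|exact: c1].
  by apply: cvg_norm; exact: c1.
have near1 : \forall t \near edot (z - x) n,
    0 < k * edot (gam t - x) xi - `|edot (gam t - x) n|.
  have : nbhs (k * edot (gam (edot (z - x) n) - x) xi -
      `|edot (gam (edot (z - x) n) - x) n|) [set s : R | 0 < s].
    by apply: lt_nbhsr; rewrite gz subr_gt0.
  by move/(cU (edot (z - x) n)).
have near2 : \forall t \near edot (z - x) n, enorm (gam t - z) < eta.
  have : nbhs (gam (edot (z - x) n)) (eball z eta) by rewrite gz; exact: nbhs_eball.
  by move/(cg (edot (z - x) n)).
have [r /= r0 rB] := (nbhs_ballP _ _).1 (filterI near1 near2).
(* A point of the arc slightly below [z], still in the cone and within [eta] of [z]. *)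
pose t := edot (z - x) n - r / 2.
have [|tc tz] := rB t.
  by rewrite /ball /= /t opprB addrC subrK gtr0_norm ?divr_gt0 //; lra.
have tV : edot (gam t - x) n = t by rewrite arc_pointV.
have tU : 0 < edot (gam t - x) xi.
  by rewrite -(pmulr_rgt0 _ k0); have := normr_ge0 (edot (gam t - x) n); lra.
have tr : enorm (gam t - x) = enorm (z - x).
  apply: arc_point_enorm; rewrite ?enorm_ge0 //.
  move: tU; rewrite arc_pointU // sqrtr_gt0 subr_gt0; exact: ltW.
have gc : in_cone x xi n k (gam t) by split=> //; lra.
have gd : enorm (gam t - x) < d by rewrite tr.
have [y Ey yg] := (fatteningP compact_E eps_gt0 _).1 (full _ tU tr).
have Vy : 0 < edot (y - x) n.
  rewrite ltNge; apply/negP => Vy.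
  have : eps + eta <= enorm (y - z).
    by apply: etaE; split=> //=; rewrite -opprB edotNl oppr_ge0.
  by have := enorm_triangle y (gam t) z; lra.
have [Uy] := seen_coords lf Ey gd gc yg; rewrite (gtr0_norm Vy) => Vy2.
have := zE y Ey; apply/negP; rewrite -ltNge; apply: lt_le_trans yg.
apply: (up_strictly_closer lf) => //; last by lra.
by rewrite tV /t ltrBlDr ltrDl divr_gt0.
Qed.

(** There is a contributor below and, reversing [n], one above. Their components along [xi] relative
    to [z] are at most [3 * k * eps], and this square enters twice, whence the constant 18. *)
Lemma full_arc_opposed x xi n k d z : local_frame E eps x xi n k d ->
  boundary F z -> enorm (z - x) < d -> 0 < edot (z - x) xi ->
  full_arc x xi (enorm (z - x)) ->
  nearly_opposed E eps (18 * k ^+ 2 * eps ^+ 2) z.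
Proof.
move=> lf bz zd U0 full; have [on _ /andP[k0 k1] /andP[d0 dk] thin] := lf.
have ke : k * eps <= 1 / 4 * eps by rewrite ler_pM2r.
have zE y : E y -> eps <= enorm (y - z) by exact: boundary_dist.
have zc := in_cone_far lf zE zd U0.
have [y' [Ey' yz' Vy']] := lower_contributor lf bz zd U0 full.
have [y [Ey yz]] := lower_contributor (local_frameN lf) bz zd U0 full.
rewrite edotNr oppr_lt0 => Vy.
have Pc w : E w -> enorm (w - z) <= eps -> Pi z w /\ enorm (w - z) = eps.
  move=> Ew wz; have h : enorm (w - z) = eps.
    by apply/eqP; rewrite eq_le wz zE.
  by split=> //; apply/(contributorsP compact_E eps_gt0 _ bz).
have [Py ye] := Pc _ Ey yz; have [Py' ye'] := Pc _ Ey' yz'.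
split=> //; exists y, y'; split=> //.
have := enorm_frame z y on; have := enorm_frame z y' on; rewrite ye ye'.
rewrite (parseval (y - z) (y' - z) on).
have e w q : edot (w - z) q = edot (w - x) q - edot (z - x) q.
  by rewrite -edotNl -edotDl opprB addrA subrK.
have [_] := seen_coords lf Ey zd zc yz; rewrite (gtr0_norm Vy).
have [_] := seen_coords lf Ey' zd zc yz'; rewrite (ltr0_norm Vy').
have := thin z y Ey zd zc yz; have := thin z y' Ey' zd zc yz'.
rewrite !ler_norml => /andP[a1 a2] /andP[b1 b2] v1 v2.
have Uz : edot (z - x) xi <= enorm (z - x).
  rewrite -ler_sqr ?nnegrE ?enorm_ge0 ?(ltW U0) // -(enorm_frame x z on).
  by rewrite lerDl sqr_ge0.
have := in_cone_quarter lf zc; rewrite ler_norml => /andP[w1 w2].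
set A := edot (y - z) xi; set B := edot (y - z) n.
set A' := edot (y' - z) xi; set B' := edot (y' - z) n.
have kE : 0 < k * eps by rewrite mulr_gt0.
have B0 : 0 < B by rewrite /B e; lra.
have B'0 : 0 < - B' by rewrite /B' e; lra.
have hA : A ^+ 2 <= (3 * k * eps) ^+ 2.
  rewrite -real_normK ?num_real // ler_sqr ?nnegrE //; last by lra.
  by rewrite ler_norml /A e; apply/andP; split; lra.
have hA' : A' ^+ 2 <= (3 * k * eps) ^+ 2.
  rewrite -real_normK ?num_real // ler_sqr ?nnegrE //; last by lra.
  by rewrite ler_norml /A' e; apply/andP; split; lra.
move=> h' h.
have hAA : A * A' <= (3 * k * eps) ^+ 2 by have := sqr_ge0 (A - A'); lra.
have hBB : eps ^+ 2 - (3 * k * eps) ^+ 2 <= B * - B'.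
  set c := (X in X <= _).
  have c2 : c <= B ^+ 2 by rewrite /c; lra.
  have c2' : c <= (- B') ^+ 2 by rewrite sqrrN /c; lra.
  have [c0|/ltW c0] := leP c 0; first by apply: le_trans c0 _; rewrite mulr_ge0 // ltW.
  rewrite -ler_sqr ?nnegrE // ?exprMn; last by rewrite mulr_ge0 // ltW.
  by rewrite [leLHS]expr2 ler_pM.
rewrite !exprMn in hAA hBB; lra.
Qed.

End Arcs.

(** * Full arcs *)

Section Radial.
Variable R : realType.
Implicit Types (x p v xi : 'rV[R]_2) (r s : R) (G : set 'rV[R]_2).

Lemma open_radial x p G r : open G -> G p -> enorm (p - x) = r -> 0 < r ->
  exists2 eta, 0 < eta & forall s, `|r - s| < eta ->
    exists2 q, G q & enorm (q - x) = s.
Proof.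
move=> oG Gp pr r0.
have /nbhs_eballP[rho rho0 rhoG] : nbhs p G by exact: open_nbhs_nbhs.
exists (Num.min r rho) => [|s]; first by rewrite lt_min r0.
rewrite lt_min => /andP[sr srho].
have s0 : 0 < s by move: sr; rewrite ltr_norml => /andP[]; lra.
have r1 : r^-1 * r = 1 by rewrite mulVf ?gt_eqF.
exists (x + (s / r) *: (p - x)).
  apply: rhoG; rewrite /eball /=.
  have -> : x + (s / r) *: (p - x) - p = (s / r - 1) *: (p - x).
    by rewrite scalerBl scale1r opprB addrCA addrA addrAC.
  rewrite enormZ pr -{2}(gtr0_norm r0) -normrM mulrBl -mulrA r1 mulr1 mul1r.
  by rewrite distrC.
by rewrite addrC addKr enormZ pr gtr0_norm ?divr_gt0 // -mulrA r1 mulr1.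
Qed.

Lemma open_half_plane x xi : open [set p : 'rV[R]_2 | 0 < edot (p - x) xi].
Proof.
apply: (open_comp (f := fun p => edot (p - x) xi)) (@open_gt _ 0).
by move=> p _; exact: continuous_edotB.
Qed.

Lemma open_half_eball x r xi : open (half_eball x r xi).
Proof.
have -> : half_eball x r xi =
    [set p | enorm (p - x) < r] `&` [set p | 0 < edot (p - x) xi] by [].
apply: openI; last exact: open_half_plane.
apply: (open_comp (f := fun p => enorm (p - x))) (@open_lt _ r).
by move=> p _; exact: continuous_enormB.
Qed.

End Radial.

(** * First full arcs, and connectedness when no arc is full *)

Section FullArcs.
Variables (R : realType) (E : set 'rV[R]_2) (eps : R).
Hypotheses (compact_E : compact E) (eps_gt0 : 0 < eps).
Implicit Types (u v w x y z p xi n : 'rV[R]_2) (d k r s : R).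
Local Notation F := (fattening E eps).
Local Notation Pi := (contributors E eps).

Lemma open_setC_fattening : open (~` F).
Proof. exact/closed_openC/closed_fattening. Qed.

Lemma nfull_arcP x xi r : ~ full_arc E eps x xi r <->
  exists p, [/\ 0 < edot (p - x) xi, enorm (p - x) = r & ~ F p].
Proof.
split=> [h|[p [U0 pr Fp]] full]; last exact: Fp (full p U0 pr).
by apply: contrapT => none; apply: h => p U0 pr; apply: contrapT => Fp; apply: none; exists p.
Qed.

Lemma nfull_arc_open x xi r : 0 < r -> ~ full_arc E eps x xi r ->
  exists2 eta, 0 < eta & forall s, `|r - s| < eta -> ~ full_arc E eps x xi s.
Proof.
move=> r0 /nfull_arcP[p [U0 pr Fp]].
have [eta eta0 etaP] := open_radial (openI open_setC_fattening (@open_half_plane _ x xi))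
  (conj Fp U0) pr r0.
exists eta => // s /etaP[q [Fq Uq] qs]; apply/nfull_arcP; by exists q.
Qed.

(* [z] maximises the distance to [x] among the limits of points outside the
   fattening at distance at most [rho], the radius of the first full arc. *)
Lemma exists_boundary_full_arc x xi n k d r c : local_frame E eps x xi n k d ->
  full_arc E eps x xi r -> r < d -> ~ F c -> 0 < edot (c - x) xi ->
  enorm (c - x) < r -> exists z, [/\ boundary F z, 0 < edot (z - x) xi,
    enorm (z - x) <= r & full_arc E eps x xi (enorm (z - x))].
Proof.
move=> lf fullr rd Fc Uc cr; have [on anti /andP[k0 k1] /andP[d0 dk] _] := lf.
have ke : k * eps <= 1 / 4 * eps by rewrite ler_pM2r.
set r' := enorm (c - x) in cr.
have r'0 : 0 < r'.
  rewrite enorm_gt0; apply/eqP => c0; move: Uc; by rewrite c0 edot0l ltxx.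
pose S := [set s | r' <= s <= r /\ full_arc E eps x xi s].
have Sr : S r by split=> //; rewrite lexx ltW.
have lbS : lbound S r' by move=> s [/andP[]].
have hiS : has_inf S by split; [exists r|exists r'].
pose rho := inf S.
have rho_le s : S s -> rho <= s by move=> Ss; exact: ge_inf hiS.2 _ Ss.
have r'rho : r' <= rho by apply: lb_le_inf => //; exists r.
have rhor : rho <= r := rho_le _ Sr.
have rho0 : 0 < rho by lra.
(* The infimum is attained, since the radii of arcs that are not full form an open set. *)
have full_rho : full_arc E eps x xi rho.
  apply: contrapT => /(nfull_arc_open rho0)[eta eta0 etaP].
  have [s Ss] := inf_adherent eta0 hiS; have := rho_le _ Ss; rewrite -/rho => h1 h2.
  by case: Ss => _; apply: etaP; rewrite ler0_norm; lra.
have nfull s : r' <= s -> s < rho -> ~ full_arc E eps x xi s.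
  move=> s1 s2 fs; have : S s by split=> //; apply/andP; split; lra.
  by move/rho_le; lra.
have r'rho' : r' < rho.
  rewrite lt_def r'rho andbT; apply/eqP => e; apply: Fc; apply: full_rho => //.
pose Q := [set p : 'rV[R]_2 | enorm (p - x) <= rho] `&`
  (closure (~` F) `&` [set p | 0 <= edot (p - x) xi]).
have cQ : compact Q.
  apply: compact_closedI; first exact: compact_enorm_le.
  apply: closedI; first exact: closed_closure.
  apply: (preimage_closed (f := fun p => edot (p - x) xi)) (@closed_ge _ 0).
  by move=> p _; exact: continuous_edotB.
have Q0 : Q c by split; [exact: ltW|split; [exact: subset_closure|exact: ltW]].
have [|z /set_mem[/= zrho [cz Uz]] zmax] :=
    compact_EVT_max (f := fun p => enorm (p - x)) (ex_intro _ c Q0) cQ.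
  by apply: continuous_subspaceT; exact: continuous_enormB.
have r'z : r' <= enorm (z - x) by apply: zmax; apply: mem_set.
(* Otherwise an arc of intermediate radius is not full and holds a complement point farther from [x]
   than [z]. *)
have ez : enorm (z - x) = rho.
  apply/eqP; rewrite eq_le zrho /= leNgt; apply/negP => zrho'.
  pose s := (enorm (z - x) + rho) / 2.
  have /nfull_arcP[p [Up ps Fp]] : ~ full_arc E eps x xi s.
    by apply: nfull; rewrite /s; lra.
  have : enorm (p - x) <= enorm (z - x).
    apply: zmax; apply: mem_set; split; first by rewrite /= ps /s; lra.
    by split; [exact: subset_closure|exact: ltW].
  by rewrite ps /s; lra.
have zE y : E y -> eps <= enorm (y - z) by exact: closureC_dist.
have U0 : 0 < edot (z - x) xi.
  rewrite lt_def Uz andbT; apply/eqP => U0.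
  have ze : enorm (z - x) <= eps by lra.
  have := cusp_le eps_gt0 on anti zE ze; rewrite U0 expr0n /= pmulr_rle0 //.
  rewrite normr_le0 => /eqP V0; have := enorm_frame x z on.
  by rewrite U0 V0 ez expr0n addr0 => /esym/eqP; rewrite sqrf_eq0 gt_eqF.
exists z; rewrite ez; split=> //; apply/boundary_fatteningP; split=> //.
exact: full_rho.
Qed.

Lemma nfattening_arc x xi n k d p1 p2 t : local_frame E eps x xi n k d ->
  ~ F p1 -> ~ F p2 -> 0 < edot (p1 - x) xi -> 0 < edot (p2 - x) xi ->
  enorm (p1 - x) = enorm (p2 - x) -> enorm (p2 - x) < d ->
  edot (p1 - x) n <= t -> t <= edot (p2 - x) n ->
  let q := arc_point x xi n (enorm (p2 - x)) t in
  [/\ ~ F q, 0 < edot (q - x) xi & enorm (q - x) = enorm (p2 - x)].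
Proof.
move=> lf F1 F2 U1 U2 e12 pd V1 V2 q; have [on _ _ _ _] := lf.
have tr : t ^+ 2 < enorm (p2 - x) ^+ 2.
  have [t0|t0] := leP 0 t.
    rewrite -(enorm_frame x p2 on) ltr_pwDl ?exprn_gt0 // ler_sqr ?nnegrE //.
    exact: le_trans V2.
  rewrite -e12 -(enorm_frame x p1 on) ltr_pwDl ?exprn_gt0 //.
  by rewrite -sqrrN -[leRHS]sqrrN ler_sqr ?nnegrE ?oppr_ge0 ?lerN2 //; lra.
have qr : enorm (q - x) = enorm (p2 - x).
  by apply: arc_point_enorm; rewrite ?enorm_ge0 // ltW.
have Uq : 0 < edot (q - x) xi by rewrite arc_pointU // sqrtr_gt0 subr_gt0.
split=> //; apply: (nfattening_between compact_E eps_gt0 lf F1 F2) => //; rewrite ?qr ?arc_pointV //.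
Qed.

(** A nonempty relatively clopen part [B] contains each fibre it meets, as fibres are arcs. Its
    radii then form a clopen subset of the interval of all radii, and hence the whole interval. *)
Lemma connected_half_eball x xi n k d : local_frame E eps x xi n k d ->
  (forall r, 0 < r -> r < d -> ~ full_arc E eps x xi r) ->
  connected (half_eball x d xi `\` F).
Proof.
move=> lf nfull B [b Bb] [U oU BU] [C cC BC]; have [on _ _ _ _] := lf.
set W := _ `\` _ in BU BC *.
have oW : open W by apply: openI; [exact: open_half_eball|exact: open_setC_fattening].
have BW : B `<=` W by rewrite BU; exact: subIsetl.
have slice p q : B p -> W q -> enorm (p - x) = enorm (q - x) -> B q.
  move=> Bp Wq pq; have [[/= pd Up] Fp] := BW _ Bp; have [[/= qd Uq] Fq] := Wq.
  rewrite /eball /= in qd pd.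
  pose gam := arc_point x xi n (enorm (q - x)).
  have gq : gam (edot (q - x) n) = q by rewrite /gam arc_pointE // ltW.
  have gp : gam (edot (p - x) n) = p by rewrite /gam -pq arc_pointE // ltW.
  pose I := [set t | Num.min (edot (p - x) n) (edot (q - x) n) <= t <=
                     Num.max (edot (p - x) n) (edot (q - x) n)].
  have cI : connected I.
    apply/connected_intervalP => s t /= /andP[s1 s2] /andP[t1 t2] v /andP[v1 v2].
    by apply/andP; split; [apply: le_trans s1 v1|apply: le_trans v2 t2].
  have cA : connected (gam @` I).
    apply: connected_continuous_connected => //.
    by apply: continuous_subspaceT; exact: continuous_arc_point.
  have AW : gam @` I `<=` W.
    move=> _ [t + <-]; rewrite /I /= minEle maxEle.
    have [VV /andP[t1 t2]|/ltW VV /andP[t1 t2]] := leP (edot (p - x) n) (edot (q - x) n).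
      have [Fg Ug eg] := nfattening_arc lf Fp Fq Up Uq pq qd t1 t2.
      by split=> //; split=> //; rewrite /eball /= eg.
    have [Fg Ug eg] := nfattening_arc lf Fq Fp Uq Up (esym pq) pd t1 t2.
    by rewrite /gam -pq; split=> //; split=> //; rewrite /eball /= eg.
  have Ip : I (edot (p - x) n) by rewrite /I /= ge_min lexx le_max lexx.
  have Iq : I (edot (q - x) n) by rewrite /I /= ge_min lexx le_max lexx !orbT.
  have AE D : B = W `&` D -> gam @` I `&` B = gam @` I `&` D.
    by move=> ->; rewrite setIA (setIidl AW).
  have : gam @` I `&` B = gam @` I.
    apply: cA; first by exists p; split=> //; exists (edot (p - x) n).
      by exists U => //; exact: AE.
    by exists C => //; exact: AE.
  move=> AB; have : (gam @` I) q by exists (edot (q - x) n).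
  by rewrite -AB => -[].
pose rad G := [set s | exists2 p, G p & enorm (p - x) = s].
have W0 p : W p -> 0 < enorm (p - x).
  move=> [[_ /= Up] _]; rewrite enorm_gt0; apply/eqP => p0.
  by move: Up; rewrite p0 edot0l ltxx.
have orad D : open D -> open (rad (W `&` D)).
  move=> oD; rewrite openE => s [p [Wp Dp] ps].
  have [|eta eta0 etaP] := open_radial (openI oW oD) (conj Wp Dp) ps.
    by rewrite -ps; exact: W0.
  by apply/nbhs_ballP; exists eta => // t; rewrite /ball /= => /etaP.
pose T := `]0, d[%classic : set R.
have cT : connected T by apply/connected_intervalP; exact: interval_is_interval.
have radT p : W p -> T (enorm (p - x)).
  by move=> Wp; rewrite /T /= in_itv /= W0 //; case: Wp => [[]].
have TB : T `&` rad B = T.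
  apply: cT.
  - by exists (enorm (b - x)); split; [exact/radT/BW|exists b].
  - by exists (rad B) => //; rewrite BU; exact: orad.
  (* The radii of [B] are closed because the radii of its relative complement are open and, by
     [slice], disjoint from them. *)
  - exists (~` rad (W `&` ~` C)).
      by apply: open_closedC; apply: orad; exact: closed_openC.
    apply/seteqP; split=> [s [Ts [p Bp ps]]|s [Ts nrad]]; split=> //.
      move=> [q [Wq Cq] qs]; apply: Cq.
      have : B q by apply: slice Bp Wq _; rewrite ps.
      by rewrite BC => -[].
    move: (Ts); rewrite /T /= in_itv /= => /andP[s0 sd].
    have /nfull_arcP[p [Up ps Fp]] := nfull s s0 sd.
    have Wp : W p by split=> //; split=> //; rewrite /eball /= ps.
    exists p => //; rewrite BC; split=> //; apply: contrapT => Cp; apply: nrad.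
    by exists p.
apply/seteqP; split=> // w Ww.
have : T (enorm (w - x)) := radT w Ww.
by rewrite -TB => -[_ [p Bp pw]]; exact: slice Bp Ww pw.
Qed.

End FullArcs.

(** * Chain singularities *)

Section ChainSingularities.
Variables (R : realType) (E : set 'rV[R]_2) (eps : R).
Hypotheses (compact_E : compact E) (eps_gt0 : 0 < eps).
Implicit Types (u v w x y z p xi n : 'rV[R]_2) (d k r s : R).
Local Notation F := (fattening E eps).
Local Notation Pi := (contributors E eps).
Local Notation C := (chain_singularities E eps).

Lemma opposed_frame x : opposed E eps x ->
  exists xi n, orthonormal xi n /\ antipodal_pair E eps x n.
Proof.
move=> [bx [y [Ey yx Ey']]]; pose n := eps^-1 *: (y - x).
have en : eps *: n = y - x by rewrite scalerA mulfV ?gt_eqF // scale1r.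
exists (perp n), n; split.
  apply/orthonormalC/orthonormal_perp.
  by rewrite enormZ yx gtr0_norm ?invr_gt0 // mulVf ?gt_eqF.
split; first by move=> w; exact: boundary_dist.
  by rewrite en addrC subrK.
by rewrite en.
Qed.

Lemma local_frame_shrink x xi n k d d' : local_frame E eps x xi n k d ->
  0 < d' -> d' <= d -> local_frame E eps x xi n k d'.
Proof.
move=> [on anti k0 /andP[d0 dk] thin] d'0 dd; split=> //.
  by rewrite d'0 (le_trans dd).
by move=> p y Ey pd; apply: thin => //; exact: lt_le_trans dd.
Qed.

Lemma edotB_enorm xi p q x : enorm xi = 1 ->
  edot (q - x) xi - enorm (p - q) <= edot (p - x) xi.
Proof.
move=> xi1; have := edot_le_enorm (q - p) xi; rewrite xi1 mulr1 (enormB q).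
have -> : edot (q - p) xi = edot (q - x) xi - edot (p - x) xi.
  by rewrite -edotNl -edotDl opprB addrA subrK.
lra.
Qed.

Lemma outward_nfattening x xi : outward_directions E eps x xi ->
  forall r, 0 < r -> exists p, [/\ 0 < edot (p - x) xi, enorm (p - x) < r & ~ F p].
Proof.
move=> /outward_directionsP[xi1 h] r r0.
have [|p [Fp]] := h (Num.min r (1 / 2)); first by rewrite lt_min r0 divr_gt0.
rewrite !lt_min => /andP[pr _] /andP[_ dp]; exists p; split=> //.
set q := _ *: _ in dp.
have := edot_le_enorm (xi - q) xi; rewrite enormB xi1 mulr1 edotDl edotNl.
rewrite -enorm_sqr xi1 expr1n => h1.
have : 0 < edot q xi by lra.
rewrite /q edotZl => h2; rewrite ltNge; apply/negP => U0.
have := mulr_ge0_le0 (_ : 0 <= (enorm (p - x))^-1) U0.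
by rewrite invr_ge0 enorm_ge0 => /(_ isT); lra.
Qed.

Lemma outward_approached x xi : outward_directions E eps x xi ->
  approached E eps x xi.
Proof.
move=> /outward_nfattening h r /h[p [U0 pr]].
move=> /(nfatteningP compact_E eps_gt0) pE; exists p; split=> // y Ey.
exact/ltW/pE.
Qed.

(** In the cusp the component along [n] is quadratic in the one along [xi], so directions to
    complement points converge to [xi]. *)
Lemma nfattening_outward x xi n : orthonormal xi n -> antipodal_pair E eps x n ->
  (forall r, 0 < r -> exists p, [/\ 0 < edot (p - x) xi, enorm (p - x) < r & ~ F p]) ->
  outward_directions E eps x xi.
Proof.
move=> on anti h; have [xi1 n1 xin] := on.
have exi : enorm xi = 1 by apply/enorm_eq; rewrite ?expr1n.
have en : enorm n = 1 by apply/enorm_eq; rewrite ?expr1n.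
apply/outward_directionsP; split=> // r r0.
pose m := Num.min r (Num.min eps (eps * (r / 4))).
have [|p [U0 pm Fp]] := h m; first by rewrite !lt_min r0 eps_gt0 mulr_gt0 // divr_gt0.
have /and3P[pr pe per] : [&& enorm (p - x) < r, enorm (p - x) < eps &
    enorm (p - x) < eps * (r / 4)] by move: pm; rewrite !lt_min.
exists p; split=> //.
have pE y : E y -> eps <= enorm (y - p).
  by move=> Ey; exact/ltW/(nfatteningP compact_E eps_gt0 p).1.
have cusp := cusp_le eps_gt0 on anti pE (ltW pe).
set U := edot (p - x) xi in U0 cusp; set V := edot (p - x) n in cusp.
have UN : U <= enorm (p - x).
  by have := edot_le_enorm (p - x) xi; rewrite exi mulr1.
have VU : `|V| <= r / 4 * U.
  rewrite -(ler_pM2l eps_gt0); apply: le_trans cusp _.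
  by rewrite mulrA expr2 ler_pM2r //; lra.
pose w := U^-1 *: (p - x).
have wxi : w - xi = (V / U) *: n.
  rewrite /w {1}(orthonormal_decomp (p - x) on) -/U -/V scalerDr !scalerA.
  by rewrite mulVf ?gt_eqF // scale1r addrC addKr mulrC.
have w0 : w != 0.
  apply/eqP => w0; have := congr1 (fun v => edot v xi) w0.
  rewrite /w edotZl -/U mulVf ?gt_eqF // edot0l; lra.
have -> : (enorm (p - x))^-1 *: (p - x) = (enorm w)^-1 *: w.
  rewrite /w enormZ gtr0_norm ?invr_gt0 // scalerA invfM invrK mulrAC.
  by rewrite mulfV ?gt_eqF // mul1r.
apply: le_lt_trans (normalize_dist exi w0) _.
rewrite wxi enormZ en mulr1 normrM normfV (gtr0_norm U0).
have : `|V| / U <= r / 4 by rewrite ler_pdivrMr.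
lra.
Qed.

(** The inner products with two opposite contributors are both nonpositive, so they vanish. *)
Lemma outward_opposed x xi n eta : boundary F x -> orthonormal xi n ->
  antipodal_pair E eps x n -> outward_directions E eps x eta ->
  edot n eta = 0 /\ (eta = xi \/ eta = - xi).
Proof.
move=> bx on [xE E1 E2] out; have [xi1 n1 xin] := on; have [eta1 _] := out.
have en : enorm n = 1 by apply/enorm_eq; rewrite ?expr1n.
have n0 : edot n eta = 0.
  have e1 : x + eps *: n - x = eps *: n by rewrite addrC addKr.
  have e2 : x - eps *: n - x = - (eps *: n) by rewrite addrC addKr.
  have := outward_le0 compact_E eps_gt0 bx (y := x + eps *: n) _ out.
  have := outward_le0 compact_E eps_gt0 bx (y := x - eps *: n) _ out.
  rewrite e1 e2 edotNl edotZl => h1 h2.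
  have {}h1 : - (eps * edot n eta) <= 0.
    apply: h1; apply/(contributorsP compact_E eps_gt0 _ bx).
    by rewrite e2 enormN enormZ en mulr1 gtr0_norm.
  have {}h2 : eps * edot n eta <= 0.
    apply: h2; apply/(contributorsP compact_E eps_gt0 _ bx).
    by rewrite e1 enormZ en mulr1 gtr0_norm.
  have /eqP : eps * edot n eta = 0 by lra.
  by rewrite mulf_eq0 (gt_eqF eps_gt0) /= => /eqP.
split=> //; have dec := orthonormal_decomp eta on.
rewrite (edotC eta n) n0 scale0r addr0 in dec.
have : edot eta xi ^+ 2 = 1.
  have := parseval eta eta on; rewrite (edotC eta n) n0 mul0r addr0 -expr2 => <-.
  by rewrite -enorm_sqr eta1 expr1n.
move/eqP; rewrite sqrf_eq1 => /orP[] /eqP e; rewrite e in dec.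
  by left; rewrite dec scale1r.
by right; rewrite dec scaleN1r.
Qed.

Lemma extremal_directions_opposed x xi n : boundary F x -> orthonormal xi n ->
  antipodal_pair E eps x n ->
  extremal_directions E eps x = outward_directions E eps x.
Proof.
move=> bx on anti; have [_ n1 _] := on; have [_ E1 _] := anti.
apply/seteqP; split=> [eta []//|eta out]; split=> //.
have e1 : x + eps *: n - x = eps *: n by rewrite addrC addKr.
have [n0 _] := outward_opposed bx on anti out.
exists (x + eps *: n); last by rewrite e1 edotZl n0 mulr0.
apply/(contributorsP compact_E eps_gt0 _ bx); split=> //.
have en : enorm n = 1 by apply/enorm_eq; rewrite ?expr1n.
by rewrite e1 enormZ en mulr1 gtr0_norm.
Qed.

Lemma nearly_opposed_le r s z : r <= s ->
  nearly_opposed E eps r z -> nearly_opposed E eps s z.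
Proof.
move=> rs [bz [y [y' [Py Py' h]]]]; split=> //; exists y, y'; split=> //; lra.
Qed.

(** If no small half disc has a connected complement part, full arcs occur at all scales. Below each
    there are complement points, and the first full arc beyond such a point carries a nearly opposed
    boundary point. *)
Lemma connected_or_chain x xi n : orthonormal xi n -> antipodal_pair E eps x n ->
  outward_directions E eps x xi ->
  (exists2 d, 0 < d & connected (half_eball x d xi `\` F)) \/
  forall d, 0 < d -> chain_towards E eps x (half_eball x d xi).
Proof.
move=> on anti out.
have [|ncon] := pselect (exists2 d, 0 < d & connected (half_eball x d xi `\` F)).
  by left.
right=> d d0.
apply/(chain_towardsP compact_E eps_gt0) => r r0.
have e2 : 0 < 18 * eps ^+ 2 by rewrite mulr_gt0 // exprn_gt0.
(* Chosen so that the defect [18 * k ^+ 2 * eps ^+ 2] is at most [r]. *)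
pose k := Num.min (1 / 4) (r / (18 * eps ^+ 2)).
have k0 : 0 < k by rewrite lt_min !divr_gt0.
have k1 : k <= 1 / 4 by rewrite ge_min lexx.
have kr : k * (18 * eps ^+ 2) <= r by rewrite -ler_pdivlMr // ge_min lexx orbT.
have k01 : 0 < k <= 1 / 4 by rewrite k0.
have [d1 lf1] := exists_local_frame compact_E eps_gt0 on anti (outward_approached out) k01.
have d10 : 0 < d1 by have [_ _ _ /andP[]] := lf1.
pose d' := Num.min d1 (Num.min r d).
have d'0 : 0 < d' by rewrite !lt_min d10 r0.
have d'1 : d' <= d1 by rewrite ge_min lexx.
have d'r : d' <= r by rewrite !ge_min lexx orbT.
have d'd : d' <= d by rewrite !ge_min lexx !orbT.
have lf := local_frame_shrink lf1 d'0 d'1.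
have [s [s0 sd fs]] : exists s, [/\ 0 < s, s < d' & full_arc E eps x xi s].
  apply: contrapT => none; apply: ncon; exists d' => //.
  apply: (connected_half_eball compact_E eps_gt0 lf) => s s0 sd fs.
  by apply: none; exists s.
have [c [Uc cs Fc]] := outward_nfattening out s0.
have [z [bz Uz zs fz]] :=
  exists_boundary_full_arc compact_E eps_gt0 lf fs sd Fc Uc cs.
have zd : enorm (z - x) < d' by lra.
exists z; split; last by lra.
  by split=> //; rewrite /eball /=; lra.
apply: nearly_opposed_le (full_arc_opposed compact_E eps_gt0 lf bz zd Uz fz).
have : k * (k * (18 * eps ^+ 2)) <= 1 / 4 * r.
  have h0 : 0 <= k * (18 * eps ^+ 2) by apply: mulr_ge0; exact: ltW.
  by apply: ler_pM => //; exact: ltW.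
rewrite expr2; lra.
Qed.

Lemma chain_singularities_opposed x : C x -> opposed E eps x.
Proof.
move=> [bx Cx]; have [A /(chain_towardsP compact_E eps_gt0) chain] :
    exists A, chain_towards E eps x A.
  case: Cx => [[_ [xi1 [xi2 [_ _ h]]]]|[_ [xi1 [xi2 [_ _ [d _ h] _]]]]
              |[_ [xi1 [xi2 [_ _ _ [d _ h]]]]]]; by eexists; exact: h.
apply: (opposed_limit compact_E eps_gt0) => r /chain[z [_ nz zx]].
by exists z.
Qed.

Lemma axis_eq0 x xi n p : orthonormal xi n -> antipodal_pair E eps x n ->
  boundary F p -> enorm (p - x) <= eps -> edot (p - x) xi = 0 -> p = x.
Proof.
move=> on anti bp pe U0.
have pE y : E y -> eps <= enorm (y - p) by exact: boundary_dist.
have := cusp_le eps_gt0 on anti pE pe; rewrite U0 expr0n /= pmulr_rle0 //.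
rewrite normr_le0 => /eqP V0; apply/eqP; rewrite -subr_eq0; apply/eqP/edot_eq0.
by rewrite (parseval (p - x) (p - x) on) U0 V0 mulr0 addr0.
Qed.

(** The approaching points have opposite contributors and form a chain on the side of [xi]. The type
    of [x] depends on the other side: no outward direction gives a one-sided chain, a connected
    complement part a sharp-chain, and a chain a chain-chain. *)
Lemma chain_singularity_side x xi n : orthonormal xi n ->
  antipodal_pair E eps x n ->
  (forall r, 0 < r -> exists p, [/\ C p, 0 < edot (p - x) xi & enorm (p - x) < r]) ->
  C x.
Proof.
move=> on anti h; have [xi1 _ _] := on.
have exi : enorm xi = 1 by apply/enorm_eq; rewrite ?expr1n.
have bx : boundary F x.
  by apply: boundary_fattening_closed => r /h[p [[bp _] _ pr]]; exists p.
have sx : singularities E eps x.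
  apply: (singularities_limit compact_E eps_gt0) => r r0.
  have [p [Cp _ pr]] := h r r0; exists p; split=> //.
  apply: (opposed_nearly compact_E eps_gt0); first exact: ltW.
  exact: chain_singularities_opposed.
have chain d : 0 < d -> chain_towards E eps x (half_eball x d xi).
  move=> d0; apply/(chain_towardsP compact_E eps_gt0) => r r0.
  have [|p [Cp Up]] := h (Num.min r d); first by rewrite lt_min r0.
  rewrite lt_min => /andP[pr pd]; exists p; split=> //.
  apply: (opposed_nearly compact_E eps_gt0); first exact: ltW.
  exact: chain_singularities_opposed.
have out : outward_directions E eps x xi.
  apply: (nfattening_outward on anti) => r r0.
  have [|p [[bp _] Up pr]] := h (r / 2); first by rewrite divr_gt0.
  have /boundary_fatteningP[_ /closure_eballP cp] := bp.
  have [|q Fq] := cp (Num.min (r / 2) (edot (p - x) xi)).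
    by rewrite lt_min Up divr_gt0.
  rewrite lt_min => /andP[q1 q2]; exists q; split=> //.
    by have := edotB_enorm q p x exi; lra.
  by have := enorm_triangle q p x; lra.
have ext := extremal_directions_opposed bx on anti.
have outP eta : outward_directions E eps x eta -> eta = xi \/ eta = - xi.
  by move=> /(outward_opposed bx on anti)[].
split=> //; have [outN|outN] := pselect (outward_directions E eps x (- xi)); last first.
  apply: Or31; split=> //; exists xi, xi; split=> //.
    rewrite ext; apply/seteqP; split=> [eta oeta|eta [->|->]] //.
    by have [->|e] := outP eta oeta; [left|rewrite e in oeta].
  apply/(chain_towardsP compact_E eps_gt0) => r r0.
  have [p [[_ Up] np pr]] := (chain_towardsP compact_E eps_gt0 _ _).1 (chain _ ltr01) r r0.
  by exists p; split=> // px; move: Up; rewrite px subrr edot0l ltxx.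
have ext2 : extremal_directions E eps x = [set - xi; xi].
  rewrite ext; apply/seteqP; split=> [eta oeta|eta [->|->]] //.
  by have [->|->] := outP eta oeta; [right|left].
have [[d d0 con]|chainN] := connected_or_chain (orthonormalNl on) anti outN.
  apply: Or33; split=> //; exists (- xi), xi; split=> //; first by exists d.
  by exists 1 => //; exact: chain.
apply: Or32; split=> //; exists (- xi), xi; split=> //.
  by exists 1 => //; exact: chainN.
by exists 1 => //; exact: chain.
Qed.

(** If chain singularities accumulate at [x] from neither side, those near [x] lie on the line
    through [x] along [n], where the only boundary point near [x] is [x] itself. *)
Lemma closed_chain_singularities : closed C.
Proof.
move=> x /closure_eballP cx; apply: contrapT => nCx.
have opp : opposed E eps x.
  apply: (opposed_limit compact_E eps_gt0) => r r0; have [p Cp pr] := cx r r0.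
  exists p; split=> //; apply: (opposed_nearly compact_E eps_gt0); first exact: ltW.
  exact: chain_singularities_opposed.
have [xi [n [on anti]]] := opposed_frame opp.
have side xi' : orthonormal xi' n -> exists2 r, 0 < r &
    forall p, C p -> enorm (p - x) < r -> edot (p - x) xi' <= 0.
  move=> on'; apply: contrapT => none; apply: nCx.
  apply: (chain_singularity_side on' anti) => r r0.
  apply: contrapT => nr; apply: none; exists r => // p Cp pr.
  by rewrite leNgt; apply/negP => Up; apply: nr; exists p.
have [r1 r10 h1] := side _ on; have [r2 r20 h2] := side _ (orthonormalNl on).
have [|p Cp] := cx (Num.min eps (Num.min r1 r2)); first by rewrite !lt_min eps_gt0 r10.
rewrite !lt_min => /and3P[pe pr1 pr2].
apply: nCx; rewrite -(axis_eq0 on anti (proj1 Cp) (ltW pe)) //.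
by have := h1 p Cp pr1; have := h2 p Cp pr2; rewrite edotNr; lra.
Qed.

(* If every small arc met [B], every such arc would be full, so that half a disc
   around [x] would lie in the fattening, leaving no boundary point there. *)
Lemma arc_missing x xi n (B : set 'rV[R]_2) d0 : orthonormal xi n ->
  antipodal_pair E eps x n -> B `<=` opposed E eps -> 0 < d0 ->
  exists r, [/\ 0 < r, r < d0 & forall p, B p -> 0 < edot (p - x) xi ->
    enorm (p - x) != r].
Proof.
move=> on anti Bopp d00; have [xi1 _ _] := on.
have exi : enorm xi = 1 by apply/enorm_eq; rewrite ?expr1n.
apply: contrapT => none.
have hit r : 0 < r -> r < d0 ->
    exists p, [/\ B p, 0 < edot (p - x) xi & enorm (p - x) = r].
  move=> r0 rd; apply: contrapT => nh; apply: none; exists r; split=> // p Bp Up.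
  by apply/eqP => pr; apply: nh; exists p.
have Bdist p y : B p -> E y -> eps <= enorm (y - p).
  by move=> /Bopp[bp _]; exact: boundary_dist.
have app : approached E eps x xi.
  move=> r r0; have m0 : 0 < Num.min r d0 by rewrite lt_min r0.
  have m1 : Num.min r d0 <= r by rewrite ge_min lexx.
  have m2 : Num.min r d0 <= d0 by rewrite ge_min lexx orbT.
  have [||p [Bp Up pr]] := hit (Num.min r d0 / 2); try lra.
  by exists p; split=> //; [lra|move=> y; exact: Bdist].
have k01 : 0 < (1 / 4 : R) <= 1 / 4 by rewrite lexx divr_gt0.
have [d1 lf1] := exists_local_frame compact_E eps_gt0 on anti app k01.
have d10 : 0 < d1 by have [_ _ _ /andP[]] := lf1.
pose d := Num.min d1 d0.
have dp : 0 < d by rewrite lt_min d10.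
have dd1 : d <= d1 by rewrite ge_min lexx.
have dd0 : d <= d0 by rewrite ge_min lexx orbT.
have lf := local_frame_shrink lf1 dp dd1.
(* The ordinates of two opposite contributors of [p] exceed [eps / 2] in absolute value, but their
   sum is less than that, so one lies above and one below. *)
have full r : 0 < r -> r < d -> full_arc E eps x xi r.
  move=> r0 rd; have [|p [Bp Up pr]] := hit r r0; first by lra.
  have pd : enorm (p - x) < d by rewrite pr.
  have pc := in_cone_far eps_gt0 lf (fun y => @Bdist p y Bp) pd Up.
  have [_ [y [Ey yp Ey']]] := Bopp p Bp.
  have ype : enorm (y - p) <= eps by rewrite yp.
  have yp' : enorm (p - (y - p) - p) <= eps.
    by rewrite addrAC subrr add0r enormN yp.
  have [_ v1] := seen_coords eps_gt0 lf Ey pd pc ype.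
  have [_ v2] := seen_coords eps_gt0 lf Ey' pd pc yp'.
  have Vp : `|edot (p - x) n| < eps / 4.
    have [_ _ _ /andP[_ dk] _] := lf.
    apply: le_lt_trans (in_cone_quarter lf pc) _.
    by have := edot_le_enorm (p - x) xi; rewrite exi mulr1; lra.
  have sum : edot (y - x) n + edot (p - (y - p) - x) n = edot (p - x) n *+ 2.
    by rewrite !(edotDl, edotNl); ring.
  rewrite -pr; move: v1 v2 Vp; rewrite ltr_norml => + + /andP[].
  have [Vy|Vy] := ger0P (edot (y - x) n);
    have [Vy'|Vy'] := ger0P (edot (p - (y - p) - x) n) => v1 v2 w1 w2; try lra.
  - apply: (two_sided_full compact_E eps_gt0 lf pd pc Ey Ey') => //; by [rewrite yp|lra].
  - apply: (two_sided_full compact_E eps_gt0 lf pd pc Ey' Ey) => //; by [rewrite yp|lra].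
(* A boundary point well inside the half disc has complement points next to it, contrary to all arcs
   being full. *)
have [||p [Bp Up pr]] := hit (d / 2); try lra.
have [/boundary_fatteningP[_ /closure_eballP cp] _] := Bopp p Bp.
have [|q Fq] := cp (Num.min (d / 2) (edot (p - x) xi)).
  by rewrite lt_min Up divr_gt0.
rewrite lt_min => /andP[q1 q2].
have Uq : 0 < edot (q - x) xi by have := edotB_enorm q p x exi; lra.
apply: Fq; apply: (full (enorm (q - x))) => //.
  by have := edot_le_enorm (q - x) xi; rewrite exi mulr1; lra.
by have := enorm_triangle q p x; lra.
Qed.

(** On each side of [x] some arc of radius below [enorm (a - x)] misses [B]; the region cut off by
    the two arcs is clopen in [B], contains [x] and excludes [a]. *)
Lemma totally_disconnected_chain_singularities : totally_disconnected C.
Proof.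
move=> x Cx; apply/seteqP; split=> [a [B [Bx BC cB] Ba]|_ ->]; last first.
  exact: connected_component_refl.
apply: contrapT => ax.
have Bopp : B `<=` opposed E eps by move=> p /BC; exact: chain_singularities_opposed.
have [xi [n [on anti]]] := opposed_frame (Bopp _ Bx).
have a0 : 0 < enorm (a - x) by rewrite enorm_gt0 subr_eq0; apply/eqP.
have d00 : 0 < Num.min (enorm (a - x)) eps by rewrite lt_min a0.
have [r1 [r10 r1d miss1]] := arc_missing on anti Bopp d00.
have [r2 [r20 r2d miss2]] := arc_missing (orthonormalNl on) anti Bopp d00.
move: r1d r2d; rewrite !lt_min => /andP[r1a r1e] /andP[r2a r2e].
(* The two half discs may have different radii; the small ball joins them across [x]. On their
   common diameter [B] contains only [x], so [O] and the closed set [D] have the same trace on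
   [B]. *)
pose O := eball x (Num.min r1 r2) `|` (half_eball x r1 xi `|` half_eball x r2 (- xi)).
pose D := ([set p | enorm (p - x) <= r1] `&` [set p | 0 <= edot (p - x) xi]) `|`
  ([set p | enorm (p - x) <= r2] `&` [set p | 0 <= edot (p - x) (- xi)]).
have oO : open O.
  apply: openU; last by apply: openU; exact: open_half_eball.
  apply: (open_comp (f := fun p => enorm (p - x))) (@open_lt _ _).
  by move=> p _; exact: continuous_enormB.
have cD : closed D.
  apply: closedU; apply: closedI.
  - apply: (preimage_closed (f := fun p => enorm (p - x))) (@closed_le _ _).
    by move=> p _; exact: continuous_enormB.
  - apply: (preimage_closed (f := fun p => edot (p - x) xi)) (@closed_ge _ _).
    by move=> p _; exact: continuous_edotB.
  - apply: (preimage_closed (f := fun p => enorm (p - x))) (@closed_le _ _).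
    by move=> p _; exact: continuous_enormB.
  - apply: (preimage_closed (f := fun p => edot (p - x) (- xi))) (@closed_ge _ _).
    by move=> p _; exact: continuous_edotB.
have Ox : O x by left; rewrite /eball /= subrr enorm0 lt_min r10.
have OD : B `&` O = B `&` D.
  apply/seteqP; split=> p [Bp].
    case=> [H|[[pr Up]|[pr Up]]]; split=> //.
    - move: H; rewrite /eball /= lt_min => /andP[p1 p2].
      have [U0|U0] := leP 0 (edot (p - x) xi); first by left; split=> //; exact: ltW.
      by right; split; [exact: ltW|rewrite /= edotNr; lra].
    - by left; split; exact: ltW.
    - by right; split; exact: ltW.
  have [bp _] := Bopp p Bp.
  case=> -[/= pr]; rewrite le_eqVlt => /orP[/eqP/esym U0|Up]; split=> //.
  - by rewrite (axis_eq0 on anti bp _ U0) //; lra.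
  - by right; left; split=> //; rewrite /eball /= lt_neqAle miss1.
  - by rewrite (axis_eq0 (orthonormalNl on) anti bp _ U0) //; lra.
  - by right; right; split=> //; rewrite /eball /= lt_neqAle miss2.
have BO : B `&` O = B.
  apply: cB; first by exists x.
  - by exists O.
  - by exists D.
have : (B `&` O) a by rewrite BO.
rewrite /O /half_eball /eball /= lt_min => -[_ [/andP[]|[[]|[]]]]; lra.
Qed.

End ChainSingularities.

Theorem theorem3 (R : realType) (E : set 'rV[R]_2) (eps : R)
    (compact_E : compact E) (eps_gt0 : 0 < eps) :
  closed (chain_singularities E eps) /\
  totally_disconnected (chain_singularities E eps).
Proof.
split; first exact: closed_chain_singularities.
exact: totally_disconnected_chain_singularities.
Qed.
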